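(* Let $\mathbf{K}$ be a field of characteristic $p>0$. Let $m\ge 2$ and $n\ge 2$ be two integers such that $mn$ is prime to $p$. Assume that $\mathbf{K}$ contains a primitive $mn$-th root of unity. Let $a\in\mathbf{K}$ be a non-zero element such that the order of the class of $a$ in $\mathbf{K}^*/\mathbf{K}^{*n}$ is equal to $n$, where $\mathbf{K}^{*n}$ denotes the group of $n$-th powers of elements of $\mathbf{K}^*$. Then $\mathbf{L}:=\mathbf{K}[X]/(X^n-a)$ is a cyclic field extension of $\mathbf{K}$ of degree $n$, and there is a normal basis of $\mathbf{L}$ over $\mathbf{K}$ with weight $\le 3n-2$ and complexity $O\big(n\,(\log n)\,|\log|\log n||\big)$, the constant implied by $O$ being absolute (independent of $\mathbf{K}$, $p$, $m$, $n$ and $a$).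
   Context: Let $\mathbf{L}/\mathbf{K}$ be a cyclic Galois extension of fields of degree $n$, with $\sigma$ a generator of $\mathrm{Gal}(\mathbf{L}/\mathbf{K})$. A normal basis of $\mathbf{L}$ over $\mathbf{K}$ is a $\mathbf{K}$-basis of the form $(\theta,\sigma(\theta),\ldots,\sigma^{n-1}(\theta))$ with $\theta\in\mathbf{L}^*$. Let $\Theta=(\theta_i)_{0\le i\le n-1}$ be a $\mathbf{K}$-basis of $\mathbf{L}$, and let $t_{i,j}^k\in\mathbf{K}$ be defined by $\theta_i\theta_j=\sum_{k=0}^{n-1}t_{i,j}^k\theta_k$. Complexity: consider straight-line programs that compute the coordinates in $\Theta$ of the product $a\times b$ from the coordinates in $\Theta$ of arbitrary $a,b\in\mathbf{L}$, and that consist of additions, subtractions, multiplications of a register by a constant (in $\mathbf{K}$), and additions, subtractions, multiplications between two registers (registers hold elements of $\mathbf{K}$). The complexity of such a program is the total number of such operations. The complexity of the basis $\Theta$ is the minimal possible complexity of such a program. Weight: when $\Theta$ is a normal basis, its weight is the number of non-zero terms in the bilinear form $c_0(a,b)=\sum_{i,j}t_{i,j}^0a_ib_j$, i.e. the number of pairs $(i,j)$ with $0\le i,j\le n-1$ and $t_{i,j}^0\neq 0$. $\log$ denotes the natural logarithm. *)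

(* Defs.v *)
From HB Require Import structures.
From mathcomp Require Import all_boot all_order all_fingroup all_algebra.
From mathcomp Require Import all_solvable all_field.
From mathcomp Require Import reals exp.

Set Implicit Arguments.
Unset Strict Implicit.
Unset Printing Implicit Defensive.

Import Order.TTheory GRing.Theory Num.Theory.
Local Open Scope ring_scope.

Definition nth_power_group (K : fieldType) (n : nat) (x : K) : Prop :=
  exists2 y : K, y != 0 & x = y ^+ n.

(* For a nonzero a, the class of a in K^* / K^*n has finite order d: its d-th
   power is trivial in the quotient, and no smaller positive power is. *)
Definition class_has_order (K : fieldType) (n : nat) (a : K) (d : nat) : Prop :=
  [/\ (0 < d)%N, nth_power_group n (a ^+ d)
    & forall e : nat, (0 < e)%N -> nth_power_group n (a ^+ e) -> (d <= e)%N].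

Section StraightLinePrograms.

Variable K : fieldType.

(* Registers are never overwritten: each instruction stores its result in a
   fresh register, numbered by the current number of registers. *)
Inductive instr : Type :=
  | AddConst of nat & K
  | SubConst of nat & K
  | MulConst of nat & K
  | AddReg of nat & nat
  | SubReg of nat & nat
  | MulReg of nat & nat.

Definition operands (o : instr) : seq nat :=
  match o with
  | AddConst i _ | SubConst i _ | MulConst i _ => [:: i]
  | AddReg i j | SubReg i j | MulReg i j => [:: i; j]
  end.

Definition instr_value (o : instr) (s : seq K) : K :=
  match o with
  | AddConst i c => s`_i + c
  | SubConst i c => s`_i - c
  | MulConst i c => s`_i * c
  | AddReg i j => s`_i + s`_j
  | SubReg i j => s`_i - s`_j
  | MulReg i j => s`_i * s`_j
  end.

Fixpoint run (prog : seq instr) (s : seq K) : seq K :=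
  if prog is o :: prog' then run prog' (rcons s (instr_value o s)) else s.

(* Excludes reads of nonexistent registers, for which s`_i would silently
   provide the constant 0. *)
Fixpoint well_formed (prog : seq instr) (nreg : nat) : bool :=
  if prog is o :: prog' then
    all (fun i => i < nreg)%N (operands o) && well_formed prog' nreg.+1
  else true.

End StraightLinePrograms.

Section Bases.

Variables (K : fieldType) (L : splittingFieldType K) (n : nat).
Implicit Type Theta : n.-tuple L.

Definition struct_const Theta (i j k : 'I_n) : K :=
  coord Theta k (tnth Theta i * tnth Theta j).

Definition coords Theta (x : L) : seq K := [seq coord Theta i x | i : 'I_n].

(* The first n registers initially hold the coordinates of x, the next n those
   of y; after the run, register out k holds the k-th coordinate of x * y. *)
Definition computes_product Theta (prog : seq (instr K)) : Prop :=
  exists out : 'I_n -> nat,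
    [/\ well_formed prog (n + n),
        forall k : 'I_n, (out k < n + n + size prog)%N
      & forall (x y : L) (k : 'I_n),
          (run prog (coords Theta x ++ coords Theta y))`_(out k)
            = coord Theta k (x * y)].

Definition has_complexity Theta (c : nat) : Prop :=
  (exists2 prog, computes_product Theta prog & size prog = c) /\
  (forall prog, computes_product Theta prog -> (c <= size prog)%N).

Definition galois_conjugates (sigma : gal_of {:L}) (theta : L) : n.-tuple L :=
  [tuple (sigma ^+ i)%g theta | i < n].

Definition normal_basis (sigma : gal_of {:L}) (theta : L) : Prop :=
  theta != 0 /\ basis_of {:L} (galois_conjugates sigma theta).

Definition weight (n_gt0 : (0 < n)%N) Theta : nat :=
  #|[set ij : 'I_n * 'I_n |
      struct_const Theta ij.1 ij.2 (Ordinal n_gt0) != 0]|.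

End Bases.

Definition cyclic_extension (K : fieldType) (L : splittingFieldType K)
    (n : nat) : Prop :=
  [/\ \dim {:L} = n, galois 1 {:L} & cyclic 'Gal({:L} / 1)].

(* Main.v *)
Require Import Defs.
From HB Require Import structures.
From mathcomp Require Import all_boot all_order all_fingroup all_algebra.
From mathcomp Require Import all_solvable all_field.
From mathcomp Require Import mpoly.
From mathcomp Require Import reals exp.
From mathcomp Require Import zify ring lra.

(** Write L = K(alpha) with alpha^n = a. The hypothesis on the order of a makes
X^n - a irreducible: the constant term of a monic factor of degree d is, up to
sign, the determinant of a matrix C with C^n = a, so that a^d is an n-th power
([power_of_divisor]). As K contains the n-th roots of unity, L is then a cyclic
extension, and a generator sigma of its Galois group multiplies alpha by a
primitive n-th root of unity c.

The normal basis is generated by theta = 1/(alpha - 1). Its conjugates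
1/(c^i alpha - 1) are fractions in alpha with distinct simple poles, so the
product of two different ones is a linear combination of these two by partial
fractions. Only the pairs (0,j), (i,0) and (i,i) can therefore contribute to
the coordinate of index 0, and there are 3n - 2 of them ([weight_kummer]).
Moreover theta = (1 + alpha + ... + alpha^(n-1)) / (a - 1) has no zero
coordinate on the powers of alpha, which gives normality, and the change of
coordinates between the conjugates of theta and the powers of alpha is a
discrete Fourier transform of length n followed by a diagonal scaling. Hence a
product in L costs three transforms and one product of polynomials, reduced by
alpha^n = a ([normal_product_correct]). By Bluestein's trick, a transform of
length n is itself a product of polynomials ([dft_cost]).

It remains to multiply polynomials of degree less than n over K with
O(n log n loglog n) operations ([mul_cost]), while K need not contain roots of
unity of smooth order. This is the algorithm of Schoenhage and Strassen, with
radix r = 2, and in characteristic 2 its variant by Schoenhage, with radix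
r = 3; both are treated together. One multiplies modulo
1 + x^N + ... + x^((r-1)N) with N a power of r. Cutting the operands into
pieces of length about sqrt N makes them polynomials in z = x^d whose
coefficients live in a similar ring of size about sqrt N, in which the
variable is a principal root of unity of sufficiently large order: a Fourier
transform over that ring consists of additions and shifts, and the pointwise
products are done recursively ([mod_mul_cost_step]). The cost per coefficient
satisfies T(log N) = 2 T(log N / 2) + O(log N), which gives the factor
log N loglog N ([mod_mul_cost_loglog]).

All the costs are established for elements of an arbitrary commutative
K-algebra, and the program is obtained by applying them to the indeterminates
of a polynomial ring, whose evaluations are all the possible inputs
([program_of_computes], [kummer_program]). *)

Set Implicit Arguments.
Unset Strict Implicit.
Unset Printing Implicit Defensive.

Import Order.TTheory GRing.Theory Num.Theory.
Local Open Scope ring_scope.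

(** * Straight-line computations in a commutative algebra *)

Section Computation.

Variables (K : fieldType) (A : comAlgType K).
Implicit Types (S T U : A -> Prop) (a b : A) (c d : nat).

(** The element 0 is available free of charge; extracting a program pays for it
with a single operation. *)
Definition or_zero S a := a = 0 \/ S a.

Definition covered S T := forall a, S a -> or_zero T a.

Inductive one_operation S : A -> Prop :=
  | OpConst a (k : K) of or_zero S a : one_operation S (a + k%:A)
  | OpScale a (k : K) of or_zero S a : one_operation S (k *: a)
  | OpAdd a b of or_zero S a & or_zero S b : one_operation S (a + b)
  | OpSub a b of or_zero S a & or_zero S b : one_operation S (a - b)
  | OpMul a b of or_zero S a & or_zero S b : one_operation S (a * b).

Definition join S T a := S a \/ T a.

(** A straight-line program seen through the elements of an algebra that it
produces: starting from S, at most c operations give all the elements of T.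
Proving a bound for indeterminates proves it for all inputs, and cost bounds
compose without any renumbering of registers. *)
Fixpoint computes c S T : Prop :=
  covered T S \/
  if c is d.+1
  then exists2 b, one_operation S b & computes d (join (eq^~ b) S) T
  else False.

Lemma covered_refl S : covered S S. Proof. by right. Qed.

Local Hint Resolve covered_refl : core.

Lemma or_zero_covered S T a : covered S T -> or_zero S a -> or_zero T a.
Proof. by move=> ST [->|/ST]; [left|]. Qed.

Lemma covered_trans S T U : covered S T -> covered T U -> covered S U.
Proof. by move=> ST TU a /ST; apply: or_zero_covered. Qed.

Lemma covered_joinl S T : covered S (join S T).
Proof. by move=> a Sa; right; left. Qed.

Lemma covered_joinr S T : covered T (join S T).
Proof. by move=> a Sa; right; right. Qed.

Lemma covered_join S T U : covered S U -> covered T U -> covered (join S T) U.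
Proof. by move=> SU TU a [/SU|/TU]. Qed.

Lemma covered_join2 S T S' T' :
  covered S S' -> covered T T' -> covered (join S T) (join S' T').
Proof.
move=> SS' TT'; apply: covered_join; apply: covered_trans; try eassumption.
  exact: covered_joinl.
exact: covered_joinr.
Qed.

Lemma one_operation_covered S T b :
  covered S T -> one_operation S b -> one_operation T b.
Proof.
by move=> ST [{}b k|{}b k|a {}b|a {}b|a {}b] *;
   constructor; apply: or_zero_covered ST _.
Qed.

Lemma computes_mono c c' S S' T T' : (c <= c')%N ->
  covered S S' -> covered T' T -> computes c S T -> computes c' S' T'.
Proof.
elim: c c' S S' => [|c IH] [|c'] S S' //= cc' SS' T'T.
- by case=> // TS; left; apply: covered_trans SS'; apply: covered_trans TS.
- by case=> // TS; left; apply: covered_trans SS'; apply: covered_trans TS.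
- case=> [TS|[b Sb bS]].
    by left; apply: covered_trans SS'; apply: covered_trans TS.
  right; exists b; first exact: one_operation_covered Sb.
  by apply: IH bS => //; apply: covered_join2.
Qed.

Lemma computes_covered c S T : covered T S -> computes c S T.
Proof. by case: c => [|c]; left. Qed.

(** The inputs remain available to the second computation, because registers are
never overwritten. *)
Lemma computes_seq c c' S T U :
  computes c S T -> computes c' (join S T) U -> computes (c + c') S U.
Proof.
elim: c S => [|c IH] S /=.
  rewrite add0n => -[] // TS TU.
  by apply: computes_mono TU => //; apply: covered_join.
case=> [TS|[b Sb bT]] TU.
  apply: (@computes_mono c' (c.+1 + c') _ _ _ _ _ _ _ TU) => //.
    by rewrite leq_addl.
  exact: covered_join.
right; exists b => //; apply: IH bT _.
by apply: computes_mono TU => //; apply: covered_join2 => //; apply: covered_joinr.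
Qed.

Lemma computes_trans c c' S T U :
  computes c S T -> computes c' T U -> computes (c + c') S U.
Proof.
move=> ST TU; apply: computes_seq ST _.
by apply: computes_mono TU => //; apply: covered_joinr.
Qed.

Lemma computes_keep c S T : computes c S T -> computes c S (join S T).
Proof.
elim: c S => [|c IH] S /=; first by case=> // TS; left; apply: covered_join.
case=> [TS|[b Sb bT]]; first by left; apply: covered_join.
right; exists b => //; apply: computes_mono (IH _ bT) => //.
by apply: covered_join2 => //; apply: covered_joinr.
Qed.

Lemma computes_join c c' S T U :
  computes c S T -> computes c' S U -> computes (c + c') S (join T U).
Proof.
move=> ST SU; apply: computes_seq ST _.
apply: computes_mono (computes_keep (S := join S T) (T := U) (c := c') _) => //.
- apply: covered_join; last exact: covered_joinr.
  by apply: covered_trans (@covered_joinl _ _); apply: covered_joinr.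
- by apply: computes_mono SU => //; apply: covered_joinl.
Qed.

Lemma computes_bigcup n (c : nat -> nat) S (T : nat -> A -> Prop) :
  (forall i, (i < n)%N -> computes (c i) S (T i)) ->
  computes (\sum_(i < n) c i) S (fun a => exists2 i, (i < n)%N & T i a).
Proof.
elim: n => [|n IH] ST; first by apply: computes_covered => a [].
rewrite big_ord_recr /=; apply: computes_mono (computes_join (IH _) (ST n _)) => //.
  move=> a [i]; rewrite ltnS leq_eqVlt => /orP[/eqP->|lt_in] Ta; right.
    by right.
  by left; exists i.
by move=> i lt_in; apply: ST; apply: ltnW.
Qed.

Lemma computes_bigcup_const n c S (T : nat -> A -> Prop) :
  (forall i, (i < n)%N -> computes c S (T i)) ->
  computes (n * c) S (fun a => exists2 i, (i < n)%N & T i a).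
Proof. by move=> /computes_bigcup; rewrite sum_nat_const card_ord. Qed.

Lemma computes_one S b : one_operation S b -> computes 1 S (eq^~ b).
Proof.
by move=> Sb; right; exists b => //; left; apply: covered_joinl.
Qed.

Lemma computes_sum n S (F : nat -> A) :
  (forall i, (i < n)%N -> or_zero S (F i)) ->
  computes n S (eq^~ (\sum_(i < n) F i)).
Proof.
elim: n => [|n IH] SF; first by left=> a ->; left; rewrite big_ord0.
rewrite -[X in computes X]addn1; apply: computes_seq (IH _) _ => [i lt_in|].
  by apply: SF; apply: ltnW.
apply: computes_one; rewrite big_ord_recr; apply: OpAdd; first by right; right.
by apply: or_zero_covered (SF n _) => //; apply: covered_joinl.
Qed.

End Computation.

#[global] Hint Resolve covered_refl : core.

(** * Extraction of programs *)

Section Programs.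

Variables (K : fieldType) (A : comAlgType K).
Implicit Types (S T U : A -> Prop) (a b : A) (c d : nat).

(** One program has to serve all the morphisms phi x at once: the induction keeps,
for each available element of A, a register holding its image whatever x is. *)
Lemma program_of_computes (X : Type) (phi : X -> {lrmorphism A -> K | *%R})
    (regs : X -> seq K) nreg c S T :
    (forall x, size (regs x) = nreg) ->
    (forall a, or_zero S a ->
       exists2 i, (i < nreg)%N & forall x, (regs x)`_i = phi x a) ->
    computes c S T ->
  exists prog : seq (instr K),
    [/\ well_formed prog nreg, (size prog <= c)%N
      & forall a, T a -> exists2 i, (i < nreg + size prog)%N
          & forall x, (run prog (regs x))`_i = phi x a].
Proof.
elim: c S regs nreg => [|c IH] S regs nreg size_regs regsS /=.
  case=> // TS; exists [::]; split=> // a /TS /regsS[i lt_i Ei].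
  by exists i; rewrite ?addn0.
case=> [TS|[b Sb bT]].
  exists [::]; split=> // a /TS /regsS[i lt_i Ei].
  by exists i; rewrite ?addn0.
have [o wf_o val_o]: exists2 o, all (fun i => i < nreg)%N (operands o)
    & forall x, instr_value o (regs x) = phi x b.
  case: Sb {bT} => [a k|a k|a a'|a a'|a a'] /regsS[i lt_i Ei].
  - exists (AddConst i k); first by rewrite /= lt_i.
    by move=> x /=; rewrite Ei rmorphD /= linearZ /= rmorph1 mulr1.
  - exists (MulConst i k); first by rewrite /= lt_i.
    by move=> x /=; rewrite Ei linearZ mulrC.
  - case/regsS=> j lt_j Ej; exists (AddReg K i j); first by rewrite /= lt_i lt_j.
    by move=> x /=; rewrite Ei Ej rmorphD.
  - case/regsS=> j lt_j Ej; exists (SubReg K i j); first by rewrite /= lt_i lt_j.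
    by move=> x /=; rewrite Ei Ej rmorphB.
  - case/regsS=> j lt_j Ej; exists (MulReg K i j); first by rewrite /= lt_i lt_j.
    by move=> x /=; rewrite Ei Ej rmorphM.
have [|a Sa|prog [wf_prog size_prog progT]] :=
  IH _ (fun x => rcons (regs x) (instr_value o (regs x))) nreg.+1 _ _ bT.
- by move=> x; rewrite size_rcons size_regs.
- have [-> | {}Sa] : a = b \/ or_zero S a.
  + by case: Sa => [->|[->|Sa]]; [right; left | left | right; right].
  + by exists nreg => // x; rewrite nth_rcons size_regs ltnn eqxx val_o.
  + have [i lt_i Ei] := regsS a Sa; exists i; first exact: ltnW.
    by move=> x; rewrite nth_rcons size_regs lt_i Ei.
- exists (o :: prog); split; rewrite /= ?wf_o //.
  by move=> a /progT[i]; rewrite addSnnS; exists i.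
Qed.

End Programs.

Opaque computes.

(** * The fast Fourier transform by shifts *)

Section Periodic.

Variables (A : Type).

(** Functions of period E represent the elements of A[y]/(y^E - 1): multiplying by
a power of y shifts the argument, which takes no operation at all. *)
Definition periodic (E : nat) (f : nat -> A) := forall u, f (u + E)%N = f u.

Lemma periodic_modn E f u : periodic E f -> f (u %% E)%N = f u.
Proof.
move=> perf; rewrite [in RHS](divn_eq u E) addnC.
by elim: (u %/ E)%N => [|q IH]; rewrite ?addn0 // mulSnr addnA perf.
Qed.

Lemma periodic_eqmod E f u v : periodic E f -> u = v %[mod E] -> f u = f v.
Proof. by move=> perf Euv; rewrite -(periodic_modn u perf) Euv periodic_modn. Qed.

End Periodic.

Lemma sum_radix (V : nmodType) n r q (F : nat -> V) : n = (r * q)%N ->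
  \sum_(i < n) F i = \sum_(i < r) \sum_(j < q) F (i + r * j)%N.
Proof.
move=> ->; elim: q => [|q IH].
  by rewrite muln0 big_ord0 big1 // => i _; rewrite big_ord0.
rewrite mulnSr big_split_ord /= IH -big_split /=.
by apply: eq_bigr => i _; rewrite big_ord_recr /= addnC.
Qed.

Section FourierTransform.

Variables (K : fieldType) (A : comAlgType K).
Implicit Types (S T U : A -> Prop) (a b : A).

(** Decimation in time with radix r. The root of unity is a power of the variable y
of A[y]/(y^E - 1), hence all the twiddle factors are shifts and only additions
are paid for. The index j is unbounded, so that the same statement provides the
inverse transform, where j is replaced by a representative of -j. *)
Lemma fft_cost r E h s (P : nat -> nat -> A) S :
    (forall i, (i < r ^ h)%N -> periodic E (P i)) -> (E %| s * r ^ h)%N ->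
    (forall i u, (i < r ^ h)%N -> or_zero S (P i u)) ->
    (0 < r)%N -> (0 < E)%N ->
  computes (h * r ^ h * (r * E)) S
    (fun a => exists j u, a = \sum_(i < r ^ h) P i (u + s * (i * j))%N).
Proof.
elim: h s P => [|h IH] s P perP Es PS r_gt0 E_gt0.
  apply: computes_covered => a [j [u ->]].
  by rewrite expn0 big_ord1 mul0n muln0 addn0; apply: (PS 0%N u).
pose Y i j u := \sum_(k < r ^ h) P (i + r * k)%N (u + s * r * (k * j))%N.
have lt_digits i k : (i < r -> k < r ^ h -> i + r * k < r ^ h.+1)%N.
  move=> lt_ir lt_k; rewrite expnS; apply: (@leq_trans (r + r * k)%N).
    by rewrite ltn_add2r.
  by rewrite -mulnS leq_mul2l lt_k orbT.
have perY i j : (i < r)%N -> periodic E (Y i j).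
  move=> lt_ir u; apply: eq_bigr => k _.
  by rewrite addnAC perP // lt_digits.
have computesY : computes (r * (h * r ^ h * (r * E))) S
    (fun a => exists2 i, (i < r)%N & exists j u, a = Y i j u).
  apply: computes_bigcup_const => i lt_ir.
  apply: (IH (s * r)%N (fun k => P (i + r * k)%N)) => //.
  - by move=> k lt_k; apply: perP; apply: lt_digits.
  - by rewrite -mulnA -expnS.
  - by move=> k u lt_k; apply: PS; apply: lt_digits.
have -> : (h.+1 * r ^ h.+1 * (r * E) =
           r * (h * r ^ h * (r * E)) + r ^ h.+1 * (E * r))%N.
  by rewrite expnS; ring.
apply: computes_trans computesY _.
have combine : computes (r ^ h.+1 * (E * r))
    (fun a => exists2 i, (i < r)%N & exists j u, a = Y i j u)
    (fun a => exists2 j, (j < r ^ h.+1)%N & exists2 u, (u < E)%N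
       & a = \sum_(i < r) Y i j (u + s * (i * j))%N).
  apply: computes_bigcup_const => j _; apply: computes_bigcup_const => u _.
  apply: (@computes_sum _ _ r _ (fun i => Y i j (u + s * (i * j))%N)) => i lt_ir.
  by right; exists i => //; eexists; eexists.
apply: computes_mono combine => // a [j [u ->]]; right.
exists (j %% r ^ h.+1)%N; first by rewrite ltn_mod expn_gt0 r_gt0.
exists (u %% E)%N; first by rewrite ltn_mod.
rewrite (sum_radix (fun i => P i (u + s * (i * j))%N) (expnS r h)).
apply: eq_bigr => i _; apply: eq_bigr => k _.
apply: (periodic_eqmod (perP _ (lt_digits _ _ (ltn_ord i) (ltn_ord k)))).
set jj := (j %% _)%N.
have [w Ew] := dvdnP Es.
have -> : (u + s * ((i + r * k) * j) =
  (u %/ E + (r * k + i) * (j %/ r ^ h.+1) * w) * E +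
    (u %% E + s * (i * jj) + s * r * (k * jj)))%N.
  rewrite {1}(divn_eq u E) {1}(divn_eq j (r ^ h.+1)) -/jj.
  rewrite [((_ + _ * w) * E)%N]mulnDl -[(_ * w * E)%N]mulnA -Ew; ring.
by rewrite modnMDl.
Qed.

End FourierTransform.

(** * Roots of 1 + y^t + ... + y^((r-1)t) *)

Section CyclotomicRelation.

Variables (B : comNzRingType) (r : nat).
Hypothesis r_gt0 : (0 < r)%N.

(** The relation on y says that y^((r-1)t) is minus the sum of the lower powers of
y^t; this eliminates the top block of t powers of y. *)
Lemma fold_top_block t (y : B) (g : nat -> B) :
    \sum_(v < r) y ^+ (t * v) = 0 ->
  \sum_(i < r * t) g i * y ^+ i =
  \sum_(i < r.-1 * t) (g i - g (r.-1 * t + i %% t)%N) * y ^+ i.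
Proof.
move=> Phi_y; have Er : (r * t = r.-1 * t + t)%N by rewrite -mulSnr prednK.
rewrite {}Er big_split_ord /=.
under [RHS]eq_bigr do rewrite mulrBl.
rewrite sumrB; congr (_ + _).
have -> : \sum_(i < r.-1 * t) g (r.-1 * t + i %% t)%N * y ^+ i =
    \sum_(i < t) g (r.-1 * t + i)%N * y ^+ i * \sum_(v < r.-1) y ^+ (t * v).
  rewrite (sum_radix (fun i => g (r.-1 * t + i %% t)%N * y ^+ i) (mulnC _ t)).
  apply: eq_bigr => i _; rewrite mulr_sumr; apply: eq_bigr => v _.
  by rewrite [(i + _)%N]addnC [(t * v)%N]mulnC modnMDl modn_small // exprD mulrCA mulrC.
rewrite -sumrN; apply: eq_bigr => i _.
move/eqP: Phi_y; rewrite -(prednK r_gt0) big_ord_recr /= addr_eq0 => /eqP->.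
by rewrite mulrN opprK exprD (mulnC t) mulrAC mulrA.
Qed.

Lemma order_of_cyclotomic_root t (y : B) :
  \sum_(v < r) y ^+ (t * v) = 0 -> y ^+ (r * t) = 1.
Proof.
move=> Phi_y; apply/eqP; rewrite -subr_eq0 mulnC exprM subrX1.
by under eq_bigr do rewrite -exprM; rewrite Phi_y mulr0.
Qed.

Lemma expr_eqmod (y : B) M i j : y ^+ M = 1 -> i = j %[mod M] -> y ^+ i = y ^+ j.
Proof. by move=> yM Eij; rewrite -(expr_mod i yM) Eij expr_mod. Qed.

Hypothesis r_prime : prime r.

(** Multiplication by c permutes the residues modulo the prime r. *)
Lemma sum_coprime_powers (y : B) c :
  \sum_(v < r) y ^+ v = 0 -> ~~ (r %| c)%N -> \sum_(v < r) y ^+ (v * c) = 0.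
Proof.
move=> Phi_y r_c; have yr : y ^+ r = 1.
  by rewrite -(muln1 r); apply: order_of_cyclotomic_root; under eq_bigr do rewrite mul1n.
have lt_mod (v : 'I_r) : (v * c %% r < r)%N by rewrite ltn_mod.
have mul_inj : injective (fun v => Ordinal (lt_mod v)).
  move=> v w [] /eqP; wlog le_vw : v w / (v <= w)%N => [IH|].
    by case/orP: (leq_total v w) => [/IH//|/IH H]; rewrite eq_sym => /H.
  rewrite eq_sym eqn_mod_dvd ?leq_mul2r ?le_vw ?orbT // -mulnBl Euclid_dvdM //.
  rewrite (negPf r_c) orbF => r_dvd; apply: val_inj => /=.
  move: r_dvd; rewrite /dvdn modn_small; last first.
    by apply: leq_ltn_trans (ltn_ord w); apply: leq_subr.
  by rewrite subn_eq0 => ?; apply/eqP; rewrite eqn_leq le_vw.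
rewrite -[RHS]Phi_y [RHS](reindex_inj mul_inj) /=.
by apply: eq_bigr => v _; rewrite expr_mod.
Qed.

(** The sums vanish even though B may have zero divisors: a geometric series would
only give the vanishing up to a factor y^c - 1. When r does not divide c the
sum over the powers of y^(r^h) splits off as a factor; otherwise y^r and c/r
satisfy the same hypothesis with a smaller h. *)
Lemma principal_root_sum h (y : B) c :
    \sum_(v < r) y ^+ (r ^ h * v) = 0 ->
  \sum_(j < r ^ h.+1) y ^+ (j * c) =
  if (r ^ h.+1 %| c)%N then (r ^ h.+1)%:R else 0.
Proof.
elim: h y c => [|h IH] y c Phi_y; have y1 := order_of_cyclotomic_root Phi_y;
  (case: ifP => [|/negbT] dvd_c; first
    (under eq_bigr => j _ do
       rewrite (@expr_eqmod _ _ _ 0 y1) ?expr0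
         ?(eqP (dvdn_mull _ _)) ?mod0n // -?expnS //;
     by rewrite sumr_const card_ord)).
  rewrite expn1 in dvd_c *; apply: sum_coprime_powers => //.
  by under eq_bigr do rewrite -[nat_of_ord _]mul1n.
have [/dvdnP[c' Ec] | r_c] := boolP (r %| c)%N; last first.
  rewrite (sum_radix (fun j => y ^+ (j * c)) (expnSr r h.+1)).
  rewrite big1 // => i _; under eq_bigr do rewrite mulnDl exprD -mulnA [y ^+ (r ^ _ * _)]exprM.
  by rewrite -mulr_sumr sum_coprime_powers ?mulr0 //; under eq_bigr do rewrite -exprM.
rewrite {}Ec in dvd_c *.
rewrite (sum_radix (fun j => y ^+ (j * (c' * r))) (expnSr r h.+1)).
have step i v : y ^+ ((i + r ^ h.+1 * v) * (c' * r)) = (y ^+ r) ^+ (i * c').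
  rewrite -exprM; apply: expr_eqmod y1 _.
  have -> : ((i + r ^ h.+1 * v) * (c' * r) = v * c' * (r * r ^ h.+1) + r * (i * c'))%N.
    by ring.
  by rewrite modnMDl.
under eq_bigr => i _ do (under eq_bigr do rewrite step; rewrite sumr_const card_ord).
rewrite sumrMnl IH.
  by rewrite expnSr dvdn_pmul2r // in dvd_c; rewrite (negPf dvd_c) mul0rn.
by rewrite -[RHS]Phi_y; apply: eq_bigr => v _; rewrite -exprM mulnA -expnS.
Qed.

End CyclotomicRelation.

(** * Polynomials modulo 1 + X^N + ... + X^((r-1)N) *)

Section CyclotomicQuotient.

Import Pdiv.CommonRing Pdiv.RingMonic.

Variables (A : comNzRingType) (r N : nat).
Hypotheses (r_gt1 : (1 < r)%N) (N_gt0 : (0 < N)%N).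

(** When r is prime and N is a power of r, this is the cyclotomic polynomial of
order rN. *)
Definition block_cyclotomic : {poly A} := \sum_(v < r) 'X^(N * v).

Let r_gt0 : (0 < r)%N := ltnW r_gt1.

Fact size_block_cyclotomic_tail :
  (size (\sum_(v < r.-1) 'X^(N * v) : {poly A})%R < (r.-1 * N).+1)%N.
Proof.
rewrite ltnS; apply: leq_trans (size_sum _ _ _) _; apply/bigmax_leqP => v _.
by rewrite size_polyXn mulnC ltn_mul2r N_gt0 ltn_ord.
Qed.

Fact block_cyclotomicE : block_cyclotomic = 'X^(r.-1 * N) + \sum_(v < r.-1) 'X^(N * v).
Proof.
rewrite /block_cyclotomic; case: (r) r_gt0 => // r' _.
by rewrite big_ord_recr addrC /= mulnC.
Qed.

Lemma size_block_cyclotomic : size block_cyclotomic = (r.-1 * N).+1.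
Proof.
by rewrite block_cyclotomicE size_polyDl size_polyXn // size_block_cyclotomic_tail.
Qed.

Lemma monic_block_cyclotomic : block_cyclotomic \is monic.
Proof.
rewrite block_cyclotomicE monicE lead_coefDl ?lead_coefXn //.
by rewrite size_polyXn size_block_cyclotomic_tail.
Qed.

Lemma mk_monic_block_cyclotomic : mk_monic block_cyclotomic = block_cyclotomic.
Proof.
rewrite /mk_monic size_block_cyclotomic monic_block_cyclotomic ltnS muln_gt0 N_gt0.
by rewrite -ltnS prednK ?r_gt1.
Qed.

Local Notation pi := (in_qpoly block_cyclotomic).

(** Identities between polynomials of low degree may be checked in the quotient. *)
Lemma in_qpoly_block_cyclotomic_inj (p q : {poly A}) :
    (size p <= r.-1 * N)%N -> (size q <= r.-1 * N)%N -> pi p = pi q -> p = q.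
Proof.
move=> size_p size_q /(congr1 val) /=.
by rewrite mk_monic_block_cyclotomic !rmodp_small ?size_block_cyclotomic.
Qed.

Lemma cyclotomic_root : \sum_(v < r) pi 'X ^+ (N * v) = 0.
Proof.
transitivity (pi block_cyclotomic).
  by rewrite rmorph_sum; apply: eq_bigr => v _; rewrite rmorphXn.
by apply: val_inj; rewrite /= mk_monic_block_cyclotomic rmodpp ?monic_block_cyclotomic.
Qed.

Lemma in_qpoly_poly n (f : nat -> A) :
  pi (\poly_(i < n) f i) = \sum_(i < n) pi (f i)%:P * pi 'X ^+ i.
Proof.
rewrite poly_def rmorph_sum; apply: eq_bigr => i _.
by rewrite -mul_polyC rmorphM rmorphXn.
Qed.

(** The low degree representative, modulo [block_cyclotomic], of the element of
A[X]/(X^(rN) - 1) encoded by f. *)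
Definition fold_poly (f : nat -> A) : {poly A} :=
  \poly_(i < r.-1 * N) (f i - f (r.-1 * N + i %% N)%N).

Lemma in_qpoly_fold f : pi (fold_poly f) = pi (\poly_(i < r * N) f i).
Proof.
rewrite !in_qpoly_poly (fold_top_block r_gt0 (fun i => pi (f i)%:P) cyclotomic_root).
by apply: eq_bigr => i _; rewrite polyCB rmorphB.
Qed.

(** In the quotient X has order dividing rN, so that X^(rN-1) is its inverse: a shift
of the argument divides by X. *)
Lemma in_qpoly_shift s (f : nat -> A) : periodic (r * N) f ->
  pi (\poly_(u < r * N) f (u + s)%N) =
  pi 'X ^+ ((r * N).-1 * s) * pi (\poly_(u < r * N) f u).
Proof.
have rN_gt0 : (0 < r * N)%N by rewrite muln_gt0 r_gt0.
have X1 := order_of_cyclotomic_root cyclotomic_root.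
move=> perf; elim: s => [|s IH].
  by rewrite muln0 mul1r; congr (pi _); apply/polyP => u; rewrite !coef_poly addn0.
have step (g : nat -> A) : periodic (r * N) g ->
    pi (\poly_(u < r * N) g u.+1) = pi 'X ^+ (r * N).-1 * pi (\poly_(u < r * N) g u).
  move=> perg; transitivity (pi 'X ^+ (r * N).-1 * pi 'X * pi (\poly_(u < r * N) g u.+1)).
    by rewrite -exprSr prednK // X1 mul1r.
  rewrite -mulrA; congr (_ * _); rewrite !in_qpoly_poly mulr_sumr.
  under eq_bigr do rewrite mulrCA -exprS.
  move: X1 perg; case: (r * N)%N rN_gt0 => // M _ X1 perg.
  rewrite big_ord_recr big_ord_recl /= addrC X1 expr0; congr (_ + _).
  by rewrite -[M.+1]add0n perg.
rewrite mulnS exprD -mulrA -IH -step; last by move=> u; rewrite addnAC perf.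
by congr (pi _); apply/polyP => u; rewrite !coef_poly addnS.
Qed.

End CyclotomicQuotient.

Lemma poly_of_periodic (A : nzRingType) n (p : {poly A}) : (size p <= n)%N ->
  \poly_(u < n) p`_(u %% n) = p.
Proof.
move=> size_p; apply/polyP => u; rewrite coef_poly.
case: ltnP => [lt_u|le_u]; first by rewrite modn_small.
by rewrite nth_default // (leq_trans size_p).
Qed.

Definition chunk (A : nzRingType) d (p : {poly A}) l := \poly_(i < d) p`_(d * l + i).

Lemma coef_sum_chunks (A : nzRingType) d m (Z : nat -> {poly A}) l i : (i < d)%N ->
    (forall l, (size (Z l) <= d)%N) ->
  (\sum_(l < m) Z l * 'X^(d * l))`_(d * l + i) = if (l < m)%N then (Z l)`_i else 0.
Proof.
move=> lt_id size_Z; rewrite coef_sum.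
have term (k : 'I_m) : (Z k * 'X^(d * k))`_(d * l + i) =
    if l == k :> nat then (Z l)`_i else 0.
  rewrite coefMXn; case: (ltngtP l k) => [lt_lk|lt_kl|->].
  - rewrite ifT // (leq_trans (n := d * l + d)%N) ?ltn_add2l //.
    by rewrite addnC -mulnS leq_mul2l lt_lk orbT.
  - rewrite ifN; last first.
      by rewrite -leqNgt (leq_trans _ (leq_addr _ _)) // leq_mul2l ltnW ?orbT.
    rewrite nth_default // (leq_trans (size_Z k)) // -addnBAC; last first.
      by rewrite leq_mul2l ltnW ?orbT.
    by rewrite -mulnBr (leq_trans _ (leq_addr _ _)) // leq_pmulr // subn_gt0.
  - by rewrite ltnNge leq_addr /= addnC addnK.
under eq_bigr do rewrite term.
case: ltnP => [lt_lm|le_ml].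
  rewrite (bigD1 (Ordinal lt_lm)) //= eqxx big1 ?addr0 // => k.
  by rewrite -val_eqE /= eq_sym => /negPf->.
by rewrite big1 // => k _; rewrite gtn_eqF // (leq_trans (ltn_ord k)).
Qed.

Lemma poly_of_chunks (A : nzRingType) d m (p : {poly A}) : (size p <= d * m)%N ->
  p = \sum_(l < m) chunk d p l * 'X^(d * l).
Proof.
have [->|d_gt0] := posnP d.
  rewrite mul0n size_poly_leq0 => /eqP->; rewrite big1 // => l _.
  by rewrite /chunk poly_def big_ord0 mul0r.
move=> size_p; apply/polyP => u; rewrite (divn_eq u d) mulnC.
rewrite coef_sum_chunks ?ltn_mod // => [|l]; last exact: size_poly.
case: ltnP => [_|le_m]; first by rewrite coef_poly ltn_mod d_gt0.
by rewrite nth_default // (leq_trans size_p) // (leq_trans _ (leq_addr _ _)) // leq_mul2l le_m orbT.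
Qed.

(** * Convolution and principal roots of unity *)

Section CyclicConvolution.

(** The coefficient of z^i in the product of the polynomials with coefficients f
and g, modulo z^M - 1. *)
Definition cyclic_conv (B : nzRingType) M (f g : nat -> B) i :=
  \sum_(l < M) \sum_(k < M | l + k == i %[mod M]) f l * g k.

Lemma rmorph_cyclic_conv (B B' : nzRingType) (phi : {rmorphism B -> B'}) M f g i :
  phi (cyclic_conv M f g i) = cyclic_conv M (phi \o f) (phi \o g) i.
Proof.
rewrite rmorph_sum; apply: eq_bigr => l _.
by rewrite rmorph_sum; apply: eq_bigr => k _; rewrite rmorphM.
Qed.

Variables (B : comNzRingType) (r h : nat) (f g : nat -> B).
Hypothesis r_prime : prime r.

Let M := (r ^ h.+1)%N.
Let M_gt0 : (0 < M)%N. Proof. by rewrite expn_gt0 prime_gt0. Qed.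

(** Exponents being natural numbers, -i is represented by i(M-1). *)
Lemma dvdn_cyclic i n : (M %| i * M.-1 + n)%N = (n == i %[mod M]).
Proof.
rewrite -(eqn_modDl (i * M.-1)) -[(_ + i)%N](addnC i) -mulnS prednK //.
by rewrite modnMl.
Qed.

Lemma inverse_dft_product (omega : B) i :
    \sum_(v < r) omega ^+ (r ^ h * v) = 0 ->
  \sum_(j < M) omega ^+ (j * (i * M.-1)) *
     ((\sum_(l < M) omega ^+ (l * j) * f l) * (\sum_(k < M) omega ^+ (k * j) * g k))
  = M%:R * cyclic_conv M f g i.
Proof.
move=> omega_root.
transitivity (\sum_(j < M) \sum_(l < M) \sum_(k < M)
    omega ^+ (j * (i * M.-1 + (l + k))) * (f l * g k)).
  apply: eq_bigr => j _; rewrite mulr_suml mulr_sumr; apply: eq_bigr => l _.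
  rewrite !mulr_sumr; apply: eq_bigr => k _.
  by rewrite !mulnDr !exprD (mulnC j l) (mulnC j k); ring.
rewrite exchange_big mulr_sumr; apply: eq_bigr => l _ /=.
rewrite exchange_big mulr_sumr [RHS]big_mkcond; apply: eq_bigr => k _ /=.
rewrite -mulr_suml (principal_root_sum (prime_gt0 r_prime) r_prime) // -/M dvdn_cyclic.
by case: ifP; rewrite ?mul0r.
Qed.

(** When i and i' agree modulo r^h, the terms with r | j cancel in the difference,
so the values of the product at these omega^j are irrelevant. This is what makes
(r-1) r^h products sufficient, instead of r^(h+1), when the product is only
wanted modulo 1 + z^(r^h) + ... + z^((r-1) r^h). *)
Lemma partial_inverse_dft (omega : B) (W : nat -> B) i i' :
    \sum_(v < r) omega ^+ (r ^ h * v) = 0 -> i = i' %[mod r ^ h] ->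
    (forall j, ~~ (r %| j)%N ->
      W j = (\sum_(l < M) omega ^+ (l * j) * f l) * (\sum_(k < M) omega ^+ (k * j) * g k)) ->
  \sum_(j < M) omega ^+ (j * (i * M.-1)) * W j - \sum_(j < M) omega ^+ (j * (i' * M.-1)) * W j
  = M%:R * (cyclic_conv M f g i - cyclic_conv M f g i').
Proof.
move=> omega_root Eii' WE; rewrite mulrBr -!(inverse_dft_product _ omega_root) -!sumrB.
have omegaM := order_of_cyclotomic_root omega_root.
apply: eq_bigr => j _; rewrite -!mulrBl.
have [/dvdnP[j' ->] | r_j] := boolP (r %| j)%N; last by rewrite -WE.
rewrite (@expr_eqmod _ omega M (j' * r * (i * M.-1)) (j' * r * (i' * M.-1))).
- by rewrite subrr !mul0r.
- by rewrite -omegaM -expnS.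
- apply/eqP; have /eqP := Eii'.
  wlog le_ii' : i i' {Eii'} / (i' <= i)%N => [IH|].
    by case/orP: (leq_total i i') => le; [rewrite eq_sym => /IH H; rewrite eq_sym; apply: H |
      apply: IH].
  rewrite !eqn_mod_dvd ?leq_mul2l ?leq_mul2r ?le_ii' ?orbT // -mulnBr -mulnBl.
  by rewrite -mulnA => dvd; rewrite dvdn_mull // /M expnS dvdn_mul // dvdn_mulr.
Qed.

(** The reduction modulo 1 + z^(r^h) + ... of a product only involves the
differences of coefficients that [partial_inverse_dft] computes. *)
Lemma product_of_chunks (y : B) :
    \sum_(v < r) y ^+ (r ^ h * v) = 0 ->
  (\sum_(l < M) f l * y ^+ l) * (\sum_(k < M) g k * y ^+ k) =
  \sum_(i < r.-1 * r ^ h)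
     (cyclic_conv M f g i - cyclic_conv M f g (r.-1 * r ^ h + i %% r ^ h)) * y ^+ i.
Proof.
move=> y_root; rewrite -(fold_top_block (prime_gt0 r_prime) _ y_root) -expnS -/M.
have yM : y ^+ M = 1 by rewrite /M expnS; apply: order_of_cyclotomic_root.
under [RHS]eq_bigr => i _ do (rewrite mulr_suml; under eq_bigr do rewrite big_mkcond mulr_suml).
rewrite [RHS]exchange_big mulr_suml; apply: eq_bigr => l _ /=.
rewrite exchange_big mulr_sumr; apply: eq_bigr => k _ /=.
have lt_M : ((l + k) %% M < M)%N by rewrite ltn_mod.
rewrite (bigD1 (Ordinal lt_M)) //= modn_mod eqxx (expr_mod _ yM) big1 => [|i].
  by rewrite exprD; ring.
rewrite -val_eqE /= eq_sym => /negPf neq_i.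
by rewrite (modn_small (ltn_ord i)) neq_i mul0r.
Qed.

End CyclicConvolution.

(** * One level of the multiplication algorithm *)

Section SchonhageStep.

Variables (K : fieldType) (A : comAlgType K) (r : nat).
Hypotheses (r_prime : prime r) (r_neq0 : r%:R != 0 :> K).
Implicit Types (S T : A -> Prop) (p q w : {poly A}).

Let r_gt1 : (1 < r)%N := prime_gt1 r_prime.
Let r_gt0 : (0 < r)%N := prime_gt0 r_prime.

Definition coefs p (a : A) := exists i : nat, a = p`_i.

Lemma computes_poly n c S (f : nat -> A) :
  (forall i, (i < n)%N -> computes c S (eq^~ (f i))) ->
  computes (n * c) S (coefs (\poly_(i < n) f i)).
Proof.
move/computes_bigcup_const; apply: computes_mono => // a [i ->].
by rewrite coef_poly; case: ifP => [lt_in|_]; [right; exists i | left].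
Qed.

Lemma fold_poly_cost N S (f : nat -> A) :
    (forall u, (u < r * N)%N -> or_zero S (f u)) -> (0 < N)%N ->
  computes (r.-1 * N) S (coefs (fold_poly r N f)).
Proof.
move=> Sf N_gt0; rewrite -[X in computes X]muln1.
have Er : (r * N = r.-1 * N + N)%N by rewrite -mulSnr prednK.
apply: computes_poly => i lt_i; apply: computes_one; apply: OpSub; apply: Sf.
  by rewrite Er (leq_trans lt_i) ?leq_addr.
by rewrite Er ltn_add2l ltn_mod.
Qed.

Definition mod_mul_cost N c := forall S p q,
  (size p <= r.-1 * N)%N -> (size q <= r.-1 * N)%N ->
  covered (coefs p) S -> covered (coefs q) S ->
  exists w, [/\ (size w <= r.-1 * N)%N,
    in_qpoly (block_cyclotomic A r N) w =
      in_qpoly (block_cyclotomic A r N) p * in_qpoly (block_cyclotomic A r N) q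
    & computes c S (coefs w)].

Section Transform.

Variables (e s h : nat).
Hypotheses (e_gt0 : (0 < e)%N) (e_def : e = (s * r ^ h)%N).

Let M := (r ^ h.+1)%N.
Let E := (r * e)%N.
Let E_gt0 : (0 < E)%N. Proof. by rewrite muln_gt0 r_gt0. Qed.

Local Notation pi := (in_qpoly (block_cyclotomic A r e)).

Definition transform_root : {poly %/ block_cyclotomic A r e} := pi 'X ^+ (E.-1 * s).

(** Since E - 1 is prime to r, the powers of the root that occur here are a
permutation of the powers of X^e. *)
Lemma transform_root_sum : \sum_(v < r) transform_root ^+ (r ^ h * v) = 0.
Proof.
have x_root := cyclotomic_root A r_gt1 e_gt0.
transitivity (\sum_(v < r) (pi 'X ^+ e) ^+ (v * E.-1)).
  apply: eq_bigr => v _; rewrite -!exprM; congr (_ ^+ _).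
  by rewrite e_def; ring.
apply: sum_coprime_powers => //.
  by rewrite -[RHS]x_root; apply: eq_bigr => v _; rewrite exprM.
apply/negP => r_dvd; have: (r %| E)%N by rewrite dvdn_mulr.
by rewrite -(prednK E_gt0) -addn1 dvdn_addr // dvdn1 gtn_eqF.
Qed.

Definition transform (F : nat -> {poly A}) j u :=
  \sum_(l < M) (F l)`_((u + s * (l * j)) %% E).

Lemma in_qpoly_transform (F : nat -> {poly A}) j : (forall l, (size (F l) <= E)%N) ->
  pi (\poly_(u < E) transform F j u) =
  \sum_(l < M) transform_root ^+ (l * j) * pi (F l).
Proof.
move=> size_F; transitivity
    (pi (\sum_(l < M) \poly_(u < E) (F l)`_((u + s * (l * j)) %% E))).
  congr (pi _); apply/polyP => u; rewrite coef_poly coef_sum.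
  case: ltnP => [lt_u|le_u]; first by apply: eq_bigr => l _; rewrite coef_poly lt_u.
  by rewrite big1 // => l _; rewrite coef_poly ltnNge le_u.
rewrite rmorph_sum; apply: eq_bigr => l _.
rewrite [LHS](in_qpoly_shift r_gt1 e_gt0 (s * (l * j)) (f := fun u => (F l)`_(u %% E))).
  by rewrite poly_of_periodic // -exprM mulnA.
by move=> u; rewrite modnDr.
Qed.

Lemma transform_cost F S :
    (forall l, (l < M)%N -> covered (coefs (F l)) S) ->
  computes (h.+1 * M * (r * E)) S (fun a => exists j u, a = transform F j u).
Proof.
move=> SF; apply: (fft_cost (P := fun l u => (F l)`_(u %% E))) => //.
- by move=> l _ u; rewrite modnDr.
- by rewrite /E e_def expnS mulnCA.
- by move=> l u lt_l; apply: (SF l lt_l); exists (u %% E)%N.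
Qed.

(** The values of the polynomial with coefficients F at the powers of the root,
brought to low degree so that the recursive products apply to them. *)
Lemma evaluation_cost F S :
    (forall l, (l < M)%N -> covered (coefs (F l)) S) ->
  computes (h.+1 * M * (r * E) + M * (r.-1 * e)) S
    (fun a => exists2 j, (j < M)%N & coefs (fold_poly r e (transform F j)) a).
Proof.
move=> SF; apply: computes_trans (transform_cost SF) _.
apply: computes_bigcup_const => j _; apply: fold_poly_cost => // u _.
by right; exists j, u.
Qed.

End Transform.


Definition step_overhead h d e :=
  let E := (r * e)%N in let M := (r ^ h.+1)%N in
  let forward := (h.+1 * M * (r * E) + M * (r.-1 * e))%N in
  ((forward + forward) + (h.+1 * M * (r * E) + r.-1 * r ^ h * (r.-1 * e * 4)
    + ((r.-1 * r ^ h).+1 * d + r.-1 * (r ^ h * d))))%N.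

(** The operands are cut into pieces of length d, that is, read as polynomials in
z = X^d with coefficients of degree less than d in X. The coefficients of their
product have degree less than 2d = (r-1)e, hence they are determined by their
images in the ring A[X]/(1 + X^e + ... + X^((r-1)e)), and there X is a principal
root of unity of order re, a multiple of r^(h+1). The product is therefore
obtained from its values at the roots of unity of order r^(h+1), of which only
(r-1) r^h are needed, each for a cost c. *)
Lemma mod_mul_cost_step h d e s c :
    (0 < d)%N -> e = (s * r ^ h)%N -> (r.-1 * e = 2 * d)%N ->
  mod_mul_cost e c ->
  mod_mul_cost (r ^ h * d) (r.-1 * r ^ h * c + step_overhead h d e).
Proof.
move=> d_gt0 e_def e_d mul_e S p q size_p size_q pS qS.
have e_gt0 : (0 < e)%N by case: e e_d {e_def mul_e} => //; lia.
set N := (r ^ h * d)%N; set t := (r ^ h)%N in e_def *.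
pose M := (r ^ h.+1)%N; pose E := (r * e)%N; pose m := (r.-1 * t)%N.
have t_gt0 : (0 < t)%N by rewrite expn_gt0 r_gt0.
have M_def : M = (r * t)%N by rewrite /M expnS.
have M_gt0 : (0 < M)%N by rewrite expn_gt0 r_gt0.
have lt_mM : (m < M)%N by rewrite M_def ltn_pmul2r // prednK.
have N_gt0 : (0 < N)%N by rewrite muln_gt0 t_gt0.
have le_eE : (r.-1 * e <= E)%N by rewrite leq_mul2r leq_pred orbT.
pose pi := in_qpoly (block_cyclotomic A r e); pose om := transform_root e s.
pose F := chunk d p; pose G := chunk d q.
have size_chunk (x : {poly A}) l : (size (chunk d x l) <= d)%N by apply: size_poly.
have size_chunkE (x : {poly A}) l : (size (chunk d x l) <= E)%N.
  by apply: leq_trans (size_chunk x l) _; apply: leq_trans le_eE; lia.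
have cov_chunk x l : covered (coefs x) S -> covered (coefs (chunk d x l)) S.
  move=> xS a [i ->]; rewrite coef_poly; case: ifP => _; last by left.
  by apply: xS; eexists.
pose a j := fold_poly r e (transform e s h F j).
pose b j := fold_poly r e (transform e s h G j).
have val_chunks x j : pi (fold_poly r e (transform e s h (chunk d x) j)) =
    \sum_(l < M) om ^+ (l * j) * pi (chunk d x l).
  by rewrite /pi in_qpoly_fold // in_qpoly_transform.
(* The values of both operands at the powers of the root. *)
pose T1 x := exists2 j, (j < M)%N & join (coefs (a j)) (coefs (b j)) x.
have costT1 : computes ((h.+1 * M * (r * E) + M * (r.-1 * e)) +
                        (h.+1 * M * (r * E) + M * (r.-1 * e))) S T1.
  have costF x : covered (coefs x) S ->
      computes (h.+1 * M * (r * E) + M * (r.-1 * e)) S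
        (fun y => exists2 j, (j < M)%N & coefs (fold_poly r e (transform e s h (chunk d x) j)) y).
    by move=> xS; apply: evaluation_cost => // l _; apply: cov_chunk.
  apply: computes_mono (computes_join (costF p pS) (costF q qS)) => // y.
  by case=> j lt_jM [ya|yb]; right; [left | right]; exists j.
(* The recursive products, with 0 as a dummy value at the points that are not
   needed; their number is (r-1) r^h = m. *)
have products j : exists w : {poly A},
    [/\ (size w <= r.-1 * e)%N,
        pi w = if (r %| j)%N then 0 else pi (a j) * pi (b j)
      & (j < M)%N -> computes (if (r %| j)%N then 0 else c)%N T1 (coefs w)].
  case: ifP => _.
    exists 0; split; rewrite ?size_poly0 /pi ?rmorph0 // => _.
    by apply: computes_covered => y [i ->]; left; rewrite coef0.
  pose S' y := if (j < M)%N then T1 y else True.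
  have [||y ay|y by_|w [size_w pi_w cost_w]] := mul_e S' (a j) (b j).
  - exact: size_poly.
  - exact: size_poly.
  - by right; rewrite /S'; case: ifP => // lt_jM; exists j => //; left.
  - by right; rewrite /S'; case: ifP => // lt_jM; exists j => //; right.
  - exists w; split=> // lt_jM; apply: computes_mono cost_w => // y.
    by rewrite /S' lt_jM; right.
have [W W_P] := boolp.choice products.
have size_W j : (size (W j) <= E)%N by case: (W_P j) => /leq_trans->.
pose T2 x := exists2 j, (j < M)%N & coefs (W j) x.
have costT2 : computes (m * c) T1 T2.
  have -> : (m * c = \sum_(j < M) if (r %| j)%N then 0 else c)%N.
    rewrite (sum_radix (fun j => if (r %| j)%N then 0 else c)%N M_def).
    transitivity (\sum_(i < r) t * (if (r %| i)%N then 0 else c))%N; last first.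
      apply: eq_bigr => i _; rewrite -[t in LHS]card_ord -sum_nat_const.
      by apply: eq_bigr => k _; rewrite dvdn_addl ?dvdn_mulr.
    rewrite /m; case: (r) r_gt0 => // r' _; rewrite big_ord_recl /= muln0 add0n.
    rewrite (eq_bigr (fun=> t * c)%N) => [|i _].
      by rewrite sum_nat_const card_ord mulnA.
    by rewrite gtnNdvd // /bump /= add1n ltnS.
  apply: (computes_bigcup (c := fun j => if (r %| j)%N then 0 else c)%N) => j lt_jM.
  by have [_ _] := W_P j; apply.
pose V i := transform e s h W i.
pose T3 x := exists i u, x = V i u.
have costT3 : computes (h.+1 * M * (r * E)) T2 T3.
  by apply: transform_cost => // l lt_l x Wx; right; exists l.
(* The coefficient of index i is reduced by the one of index i' i, which lies in
   the top block and agrees with it modulo r^h. *)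
pose i' i := (r.-1 * t + i %% t)%N.
pose D i u := V (i * M.-1)%N u - V (i' i * M.-1)%N u.
pose conv i := cyclic_conv M F G i - cyclic_conv M F G (i' i).
pose R i : {poly A} :=
  if (i < m)%N then ((M%:R^-1 : K)%:A : A) *: fold_poly r e (D i) else 0.
have size_cyclic_conv i : (size (cyclic_conv M F G i) <= r.-1 * e)%N.
  rewrite e_d; apply: leq_trans (size_sum _ _ _) _; apply/bigmax_leqP => l _.
  apply: leq_trans (size_sum _ _ _) _; apply/bigmax_leqP => k _.
  apply: leq_trans (size_polyMleq _ _) _; apply: leq_trans (leq_pred _) _.
  by rewrite mul2n -addnn leq_add // size_chunk.
have D_conv i : fold_poly r e (D i) = M%:R * conv i.
  apply: (in_qpoly_block_cyclotomic_inj r_gt1 e_gt0); first exact: size_poly.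
    rewrite mulr_natl -scaler_nat; apply: leq_trans (size_scale_leq _ _) _.
    by apply: leq_trans (size_polyD _ _) _; rewrite geq_max size_polyN !size_cyclic_conv.
  rewrite in_qpoly_fold // rmorphM rmorph_nat rmorphB /= !rmorph_cyclic_conv.
  rewrite -(@partial_inverse_dft _ r h _ _ r_prime om (fun j => pi (W j))).
  - rewrite -/M -!in_qpoly_transform // -rmorphB; congr (pi _).
    by apply/polyP => u; rewrite coefB !coef_poly; case: ifP => _; rewrite ?subr0.
  - exact: transform_root_sum.
  - by rewrite /i' modnMDl modn_mod.
  - move=> j /negPf r_j; have [_ -> _] := W_P j; rewrite r_j.
    by rewrite /a /b !val_chunks.
have M_neq0 : M%:R != 0 :> K by rewrite natrX expf_neq0.
have R_conv i : (i < m)%N -> R i = conv i.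
  rewrite /R => ->; rewrite D_conv mulr_natl -scaler_nat scalerA.
  rewrite [X in X *: _](_ : _ = 1) ?scale1r //.
  by rewrite mulr_algl -(scaler_nat (R := K)) scalerA mulVf // scale1r.
have size_R i : (size (R i) <= r.-1 * e)%N.
  rewrite /R; case: ifP; rewrite ?size_poly0 // => _.
  by apply: leq_trans (size_scale_leq _ _) _; apply: size_poly.
pose T4 x := exists2 i, (i < m)%N & coefs (R i) x.
have costT4 : computes (m * (r.-1 * e * 4)) T3 T4.
  apply: computes_bigcup_const => i lt_im; rewrite /R lt_im.
  pose f u := (M%:R^-1 : K) *: (D i u - D i (r.-1 * e + u %% e)%N).
  apply: computes_mono (computes_poly (f := f) (n := (r.-1 * e)%N) (c := 4) (S := T3) _) => //.
    move=> x [u ->]; right; exists u; rewrite coefZ !coef_poly.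
    by case: ifP => _; rewrite ?mulr0 // mulr_algl.
  have T3_D v : computes 1 T3 (eq^~ (D i v)).
    by apply: computes_one; apply: OpSub; right; do 2!eexists.
  move=> u _; rewrite -[4%N]/(1 + 1 + (1 + 1))%N.
  apply: computes_trans (computes_join (T3_D u) (T3_D (r.-1 * e + u %% e)%N)) _.
  apply: computes_trans (computes_one (OpSub _ _)) (computes_one (OpScale _ _)).
  - by right; left.
  - by right; right.
  - by right.
(* The coefficients R_i have length up to 2d: in the value at z = X^d, the upper
   half of one overlaps the lower half of the next. *)
pose Z l := take_poly d (R l) + (if l is l'.+1 then drop_poly d (R l') else 0).
have size_Z l : (size (Z l) <= d)%N.
  apply: leq_trans (size_polyD _ _) _; rewrite geq_max size_take_poly /=.
  case: l => [|l]; first by rewrite size_poly0.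
  by rewrite size_drop_poly leq_subLR addnn -mul2n -e_d size_R.
pose Y := \sum_(l < m.+1) Z l * 'X^(d * l).
have Y_R : Y = \sum_(i < m) conv i * 'X^(d * i).
  rewrite /Y; under eq_bigr do rewrite /Z mulrDl.
  rewrite big_split /= big_ord_recr /= [R m]/R ltnn take_poly0r mul0r addr0.
  rewrite [X in _ + X]big_ord_recl mul0r add0r /= -big_split /=.
  apply: eq_bigr => i _; rewrite /bump add1n mulnS exprD mulrA -mulrDl.
  by rewrite -[X in (take_poly _ _ + X)]/(_ * _) poly_take_drop R_conv.
pose T5 x := exists2 l, (l < m.+1)%N & coefs (Z l) x.
have costT5 : computes (m.+1 * d) T4 T5.
  apply: computes_bigcup_const => l lt_l; rewrite -[X in computes X]muln1.
  have R_T4 i u : or_zero T4 (R i)`_u.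
    have [lt_im|le_mi] := ltnP i m; first by right; exists i => //; exists u.
    by left; rewrite /R ltnNge le_mi coef0.
  apply: computes_mono (computes_poly (f := fun u => (Z l)`_u) (n := d) (c := 1) _) => //.
    move=> x [u ->]; right; exists u; rewrite coef_poly.
    by case: ltnP => // le_du; rewrite nth_default // (leq_trans (size_Z l)).
  move=> u lt_ud; apply: computes_one; rewrite /Z coefD coef_take_poly lt_ud.
  apply: OpAdd => //; case: (l) => [|l']; first by left; rewrite coef0.
  by rewrite coef_drop_poly.
have Y_T5 u : or_zero T5 Y`_u.
  rewrite (divn_eq u d) mulnC coef_sum_chunks ?ltn_mod //.
  by case: ifP => [lt_l|_]; [right; exists (u %/ d)%N => //; eexists | left].
have size_Y : (size Y <= r * N)%N.
  apply: leq_trans (size_sum _ _ _) _; apply/bigmax_leqP => l _.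
  apply: leq_trans (size_polyMleq _ _) _; rewrite size_polyXn addnS /=.
  apply: (@leq_trans (d + d * m)%N).
    by rewrite leq_add // leq_mul2l -ltnS ltn_ord orbT.
  by rewrite -mulnS mulnC /N mulnA leq_mul2r -M_def lt_mM orbT.
exists (fold_poly r N (fun u => Y`_u)); split; first exact: size_poly.
  rewrite in_qpoly_fold //.
  rewrite (_ : \poly_(i < r * N) Y`_i = Y); last first.
    by apply/polyP => u; rewrite coef_poly; case: ltnP => // /(leq_trans size_Y)/(nth_default 0)->.
  have chunks (x : {poly A}) : (size x <= r.-1 * N)%N ->
      in_qpoly (block_cyclotomic A r N) x =
      \sum_(l < M) in_qpoly (block_cyclotomic A r N) (chunk d x l)
         * (in_qpoly (block_cyclotomic A r N) 'X ^+ d) ^+ l.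
    move=> size_x; rewrite {1}(@poly_of_chunks _ d M x) ?rmorph_sum.
      by apply: eq_bigr => l _; rewrite rmorphM rmorphXn exprM.
    apply: leq_trans size_x _; rewrite /N M_def mulnA mulnC leq_mul2l.
    by rewrite leq_mul2r leq_pred !orbT.
  rewrite (chunks p) // (chunks q) //.
  rewrite [RHS](@product_of_chunks _ r h (fun l => in_qpoly (block_cyclotomic A r N) (chunk d p l))
    (fun l => in_qpoly (block_cyclotomic A r N) (chunk d q l))) //.
    rewrite Y_R rmorph_sum; apply: eq_bigr => i _.
    by rewrite rmorphM rmorphXn exprM rmorphB /= !rmorph_cyclic_conv.
  rewrite -[RHS](cyclotomic_root A r_gt1 N_gt0); apply: eq_bigr => v _.
  by rewrite -exprM /N -/t; congr (_ ^+ _); ring.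
have costw : computes (r.-1 * N) T5 (coefs (fold_poly r N (fun u => Y`_u))).
  by apply: fold_poly_cost.
have := computes_trans costT1 (computes_trans costT2 (computes_trans costT3
  (computes_trans costT4 (computes_trans costT5 costw)))).
by apply: computes_mono => //; rewrite /step_overhead -/M -/E -/t -/N -/m; lia.
Qed.

End SchonhageStep.

(** * The recursion *)

Section FastMultiplication.

Variables (K : fieldType) (A : comAlgType K) (r : nat).
Hypotheses (r_small : (r == 2) || (r == 3)) (r_neq0 : r%:R != 0 :> K).
Implicit Types (S T : A -> Prop) (p q w : {poly A}).

Let r_prime : prime r. Proof. by case/orP: r_small => /eqP->. Qed.
Let r_gt1 : (1 < r)%N := prime_gt1 r_prime.
Let r_gt0 : (0 < r)%N := prime_gt0 r_prime.

Lemma mod_mul_cost_mono N c c' :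
  (c <= c')%N -> mod_mul_cost A r N c -> mod_mul_cost A r N c'.
Proof.
move=> le_cc' mulN S p q size_p size_q pS qS.
have [w [size_w val_w cost_w]] := mulN S p q size_p size_q pS qS.
by exists w; split=> //; apply: computes_mono cost_w.
Qed.

(** The quadratic algorithm, which starts the recursion. *)
Lemma mod_mul_cost_schoolbook N : (0 < N)%N ->
  mod_mul_cost A r N (r * N * (r.-1 * N + r.-1 * N) + r.-1 * N).
Proof.
move=> N_gt0 S p q size_p size_q pS qS; pose E := (r * N)%N; pose D := (r.-1 * N)%N.
have E_gt0 : (0 < E)%N by rewrite muln_gt0 r_gt0.
have x_root := order_of_cyclotomic_root (cyclotomic_root A r_gt1 N_gt0).
pose g i u := p`_i * q`_((u + i * E.-1) %% E).
(* E - 1 stands for -1 modulo E: g i is p_i times q multiplied by X^i. *)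
pose f u := \sum_(i < D) g i u.
exists (fold_poly r N f); split; first exact: size_poly.
  rewrite in_qpoly_fold //.
  transitivity (\sum_(i < D) in_qpoly (block_cyclotomic A r N) (p`_i)%:P *
     in_qpoly (block_cyclotomic A r N) (\poly_(u < E) q`_((u + i * E.-1) %% E))).
    under [RHS]eq_bigr do rewrite -rmorphM; rewrite -rmorph_sum; congr (in_qpoly _ _).
    apply/polyP => u; rewrite coef_poly coef_sum.
    by case: ifP => lt_u; [|rewrite big1 //]; [apply: eq_bigr|]; move=> i _;
       rewrite coefCM coef_poly lt_u ?mulr0.
  rewrite -[p in RHS](poly_of_periodic size_p) in_qpoly_poly mulr_suml.
  apply: eq_bigr => i _; rewrite modn_small // -mulrA; congr (_ * _).
  rewrite [LHS](in_qpoly_shift r_gt1 N_gt0 (i * E.-1) (f := fun u => q`_(u %% E)));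
    last by move=> u; rewrite modnDr.
  rewrite poly_of_periodic //; last by rewrite (leq_trans size_q) // leq_mul2r leq_pred orbT.
  congr (_ * _); apply: expr_eqmod x_root _; rewrite -/E.
  rewrite -(modnMDl i (E.-1 * _)) -(modnMDl (i * E.-1) i).
  by congr (_ %% _)%N; case: (E) E_gt0 => // E' _ /=; ring.
have cost_f : computes (E * (D + D)) S (fun a => exists2 u, (u < E)%N & a = f u).
  apply: computes_bigcup_const => u _.
  have cost_g : computes (D * 1) S (fun a => exists2 i, (i < D)%N & a = g i u).
    apply: computes_bigcup_const => i lt_i.
    by apply: computes_one; apply: OpMul; [apply: pS | apply: qS]; eexists.
  rewrite muln1 in cost_g; apply: computes_trans cost_g _.
  by apply: (computes_sum (F := g^~ u)) => i lt_i; right; exists i.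
apply: computes_trans cost_f _; apply: fold_poly_cost => // u lt_u.
by right; exists u.
Qed.

(** Chosen for the sake of (r-1) r^delta = 2: by this equality the rings of the
recursive products have exactly twice the length of a piece, for both radices. *)
Let delta := (3 - r)%N.

Lemma step_overhead_le h d e : (0 < d)%N -> e = (r ^ delta * d)%N ->
  (step_overhead r h d e <= 120 * h.+1 * (r ^ h * d))%N.
Proof.
move=> d_gt0 ->; rewrite /step_overhead /delta expnS.
have bound x y t : (x + y < 120)%N -> (0 < t)%N ->
    (x * (h.+1 * (t * d)) + y * (t * d) + d <= 120 * h.+1 * (t * d))%N.
  move=> lt_xy t_gt0; apply: (@leq_trans ((x + y + 1) * (h.+1 * (t * d)))%N).
    have le_d : (d <= t * d)%N by rewrite leq_pmull.
    have le_td : (t * d <= h.+1 * (t * d))%N by rewrite leq_pmull.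
    rewrite !mulnDl mul1n !leq_add // ?leq_mul2l ?le_td ?orbT //.
    exact: leq_trans le_d le_td.
  by rewrite -mulnA leq_mul2r addn1 lt_xy orbT.
case/orP: r_small => /eqP->.
  have -> : (2 ^ (3 - 2) * d = 2 * d)%N by [].
  apply: leq_trans (bound 48%N 18%N (2 ^ h)%N isT (expn_gt0 2 h)).
  by rewrite -[2.-1]/1%N; set t := (2 ^ h)%N; lia.
have -> : (3 ^ (3 - 3) * d = d)%N by rewrite mul1n.
apply: leq_trans (bound 81%N 32%N (3 ^ h)%N isT (expn_gt0 3 h)).
by rewrite -[3.-1]/2%N; set t := (3 ^ h)%N; lia.
Qed.

(** A step replaces u by its half, rounded up, and doubles the cost per coefficient,
up to an additional O(u). The quantity u - 1 is at most halved by the rounding,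
which is why it appears in the main term: each of the s levels contributes
O(u - 1) per coefficient. The term 33 u carries the cost of the base case u = 1
through the levels, its rounding errors being absorbed by the main term. *)
Lemma mod_mul_cost_loglog s u : (0 < u <= 2 ^ s)%N ->
  mod_mul_cost A r (r ^ (u + 2 * delta))
    (r.-1 * r ^ (u + 2 * delta) * (400 * u.-1 * s + 33 * u)).
Proof.
(* For u = 1 the schoolbook cost is at most 33 (r-1) N, where N = 8 or N = 3. *)
have base v : mod_mul_cost A r (r ^ (1 + 2 * delta))
    (r.-1 * r ^ (1 + 2 * delta) * (v + 33 * 1)).
  have N_gt0 : (0 < r ^ (1 + 2 * delta))%N by rewrite expn_gt0 r_gt0.
  apply: mod_mul_cost_mono (mod_mul_cost_schoolbook N_gt0).
  apply: (@leq_trans (r.-1 * r ^ (1 + 2 * delta) * 33)%N); last first.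
    by rewrite leq_mul2l leq_addl orbT.
  by rewrite /delta; case/orP: r_small => /eqP->.
elim: s u => [|s IH] u.
  by rewrite expn0 => u1; have -> : u = 1%N by lia; apply: base.
case/andP=> u_gt0 le_u; have [u_le1|u_gt1] := leqP u 1.
  by have -> : u = 1%N by lia; apply: base.
pose u' := (u - u./2)%N; pose h := (u./2 + delta)%N.
have u'_bounds : (0 < u' <= 2 ^ s)%N by rewrite expnS in le_u; rewrite /u'; lia.
have le_h : (h <= u' + 2 * delta)%N by rewrite /h /u'; lia.
have e_d : (r ^ (u' + 2 * delta) = r ^ delta * r ^ (u' + delta))%N.
  by rewrite -expnD; congr (_ ^ _)%N; ring.
have r_delta : (r.-1 * r ^ delta = 2)%N.
  by rewrite /delta; case/orP: r_small => /eqP->.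
have N_def : (r ^ h * r ^ (u' + delta) = r ^ (u + 2 * delta))%N.
  by rewrite -expnD; congr (_ ^ _)%N; rewrite /h /u'; lia.
have s_def : (r ^ (u' + 2 * delta) = r ^ (u' + 2 * delta - h) * r ^ h)%N.
  by rewrite -expnD subnK.
have e_2d : (r.-1 * r ^ (u' + 2 * delta) = 2 * r ^ (u' + delta))%N.
  by rewrite e_d mulnA r_delta.
have := mod_mul_cost_step r_prime r_neq0 
  (h := h) (s := r ^ (u' + 2 * delta - h)) _ s_def e_2d (IH u' u'_bounds).
rewrite expn_gt0 r_gt0 N_def => /(_ isT); apply: mod_mul_cost_mono.
have := step_overhead_le h (d := r ^ (u' + delta)) _ e_d.
rewrite expn_gt0 r_gt0 N_def => /(_ isT) extra.
set k := (u + 2 * delta)%N in N_def extra *.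
apply: leq_trans (leq_add (leqnn _) extra) _.
set c := (400 * u'.-1 * s + 33 * u')%N.
have -> : (r.-1 * r ^ h * (r.-1 * r ^ (u' + 2 * delta) * c) = r.-1 * r ^ k * (2 * c))%N.
  by rewrite e_2d -N_def; ring.
apply: (@leq_trans (r.-1 * r ^ k * (2 * c) + r.-1 * r ^ k * (120 * h.+1))%N).
  rewrite leq_add2l mulnC -mulnA leq_pmull //.
  by case/orP: r_small => /eqP->.
rewrite -mulnDr leq_mul2l; apply/orP; right.
have le_s : (2 * (u'.-1 * s) <= u.-1 * s)%N.
  by rewrite mulnA leq_mul2r /u'; apply/orP; right; lia.
have le_delta : (delta <= 1)%N by rewrite /delta; case/orP: r_small => /eqP->.
(* As u >= 2, we have h + 1 <= 3 (u - 1), and 400 exceeds 3 * 120 + 33. *)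
have : (120 * h.+1 + 66 * u' <= 400 * u.-1 + 33 * u)%N by rewrite /h /u'; lia.
rewrite /c mulnS; nia.
Qed.

End FastMultiplication.

(** * Products of polynomials and Fourier transforms of arbitrary length *)

Section PolynomialProduct.

Definition mul_bound n :=
  let l := up_log 2 (2 * n) in (8 * (1000 * (n * l * up_log 2 l)))%N.

Definition dft_bound n := (4 * n + mul_bound (2 * n))%N.

(** The identity behind Bluestein's trick: it writes ij with functions of i, of j
and of i + j alone. *)
Lemma bin2_add i j : 'C(i + j, 2) = ('C(i, 2) + 'C(j, 2) + i * j)%N.
Proof.
elim: i => [|i IH]; first by rewrite add0n mul0n addn0.
by rewrite addSn !binS !bin1 IH mulSn; lia.
Qed.

Variables (K : fieldType) (A : comAlgType K) (r : nat).
Hypotheses (r_small : (r == 2) || (r == 3)) (r_neq0 : r%:R != 0 :> K).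
Implicit Types (S T : A -> Prop) (p q w : {poly A}).

(** For N large enough the product is not affected by the reduction modulo
[block_cyclotomic]. *)
Lemma mul_cost n S p q : (1 < n)%N ->
    (size p <= n)%N -> (size q <= n)%N ->
    covered (coefs p) S -> covered (coefs q) S ->
  computes (mul_bound n) S (coefs (p * q)).
Proof.
move=> n_gt1 size_p size_q pS qS; rewrite /mul_bound.
set l := up_log 2 (2 * n); pose s := up_log 2 l; pose u := up_log r (2 * n).
have r_gt1 : (1 < r)%N by case/orP: r_small => /eqP->.
have n2_gt1 : (1 < 2 * n)%N by lia.
have u_gt0 : (0 < u)%N by rewrite up_log_gt0 r_gt1.
have le_ul : (u <= l)%N.
  apply: up_log_min => //; apply: leq_trans (up_logP _ (isT : 1 < 2)%N) _.
  by rewrite leq_exp2r // up_log_gt0 n2_gt1.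
have le_us : (0 < u <= 2 ^ s)%N.
  by rewrite u_gt0 (leq_trans le_ul) // up_logP.
have s_gt0 : (0 < s)%N.
  rewrite up_log_gt0 /=; have := up_logP (2 * n) (isT : 1 < 2)%N; rewrite -/l.
  by case: (l) => [|[|]] //; rewrite ?expn0 ?expn1; lia.
pose N := (r ^ (u + 2 * (3 - r)))%N.
have N_gt0 : (0 < N)%N by rewrite expn_gt0 ltnW.
have le_nN : (n + n <= r.-1 * N)%N.
  rewrite addnn -mul2n; apply: leq_trans (up_logP (2 * n) r_gt1) _.
  rewrite -/u /N expnD; apply: leq_trans (leq_pmulr _ _) (leq_pmull _ _).
    by rewrite expn_gt0 ltnW.
  by rewrite -subn1 subn_gt0.
have le_N : (r.-1 * N <= 16 * n)%N.
  have : (r ^ u <= r * (2 * n))%N.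
    by rewrite -(prednK u_gt0) expnS leq_mul2l ltnW ?orbT // up_log_gtn.
  rewrite /N expnD; case/orP: r_small => /eqP->.
    rewrite -[2.-1]/1%N -[(2 ^ (2 * _))%N]/4%N; lia.
  rewrite -[3.-1]/2%N -[(3 ^ (2 * _))%N]/1%N; lia.
have leN (x : {poly A}) : (size x <= n)%N -> (size x <= r.-1 * N)%N.
  by move=> size_x; apply: leq_trans size_x (leq_trans (leq_addr n n) le_nN).
have [w [size_w val_w cost_w]] :=
  mod_mul_cost_loglog r_small r_neq0 le_us (leN _ size_p) (leN _ size_q) pS qS.
have <- : w = p * q.
  apply: (in_qpoly_block_cyclotomic_inj r_gt1 N_gt0) => //; last by rewrite val_w rmorphM.
  apply: leq_trans (size_polyMleq _ _) _; apply: leq_trans (leq_pred _) _.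
  by apply: leq_trans le_nN; apply: leq_add.
apply: computes_mono cost_w => //; rewrite -/N.
apply: (@leq_trans (16 * n * (433 * (l * s)))%N).
  apply: leq_mul => //; apply: (@leq_trans (400 * (l * s) + 33 * (l * s))%N); last by lia.
  apply: leq_add; last by rewrite leq_mul2l (leq_trans le_ul) // leq_pmulr.
  by rewrite -mulnA leq_mul2l leq_mul2r (leq_trans (leq_pred u)) ?orbT.
have -> : (16 * n * (433 * (l * s)) = 16 * (433 * (n * l * s)))%N by ring.
rewrite -/s; move: (n * l * s)%N => X; lia.
Qed.

(** Bluestein's trick: with y_i = zeta^(-C(i,2)) x_i, the transform is, up to the
factor zeta^(-C(j,2)), the correlation of the y_i with the constants
zeta^(C(k,2)), hence a slice of a product of polynomials. *)
Lemma dft_cost (zeta : K) n S (x : nat -> A) : (0 < n)%N -> zeta != 0 ->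
    (forall i, (i < n)%N -> or_zero S (x i)) ->
  computes (dft_bound n) S
    (fun b => exists2 j, (j < n)%N & b = \sum_(i < n) (zeta ^+ (i * j))%:A * x i).
Proof.
move=> n_gt0 zeta_neq0 xS.
pose y i := (zeta ^- 'C(i, 2)) *: x i.
(* Reversing the y_i turns the correlation into a product. *)
pose p := \poly_(i < n) y (n.-1 - i)%N.
pose q := \poly_(k < 2 * n) (zeta ^+ 'C(k, 2))%:A : {poly A}.
have cost_p : computes (n * 1) S (coefs p).
  apply: computes_poly => i lt_i; apply: computes_one; apply: OpScale; apply: xS.
  by lia.
have cost_q : computes (2 * n * 1) S (coefs q).
  apply: computes_poly => i lt_i; apply: computes_one.
  by rewrite -[X in one_operation _ X]add0r; apply: OpConst; left.
have cost_pq : computes (mul_bound (2 * n)) (join (coefs p) (coefs q)) (coefs (p * q)).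
  apply: mul_cost; first by lia.
  - by apply: leq_trans (size_poly _ _) _; lia.
  - exact: size_poly.
  - exact: covered_joinl.
  - exact: covered_joinr.
have coef_pq j : (j < n)%N -> \sum_(i < n) (zeta ^+ (i * j))%:A * x i =
    zeta ^- 'C(j, 2) *: (p * q)`_(n.-1 + j).
  move=> lt_j; rewrite coefM.
  have -> : \sum_(i < (n.-1 + j).+1) p`_i * q`_(n.-1 + j - i) =
            \sum_(i < n) p`_i * q`_(n.-1 + j - i).
    have le_n : (n <= (n.-1 + j).+1)%N by lia.
    rewrite (big_ord_widen _ (fun i => p`_i * q`_(n.-1 + j - i)) le_n) [RHS]big_mkcond /=.
    by apply: eq_bigr => i _; case: ifP => // lt_in; rewrite coef_poly lt_in mul0r.
  rewrite (reindex_inj rev_ord_inj) scaler_sumr; apply: eq_bigr => i _ /=.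
  have lt_i := ltn_ord i.
  rewrite !coef_poly !ifT; [|lia|lia].
  have -> : (n - i.+1 = n.-1 - i)%N by lia.
  have -> : (n.-1 + j - i = (n.-1 - i) + j)%N by lia.
  rewrite /y; set k := (n.-1 - i)%N.
  rewrite mulr_algl -scalerAl -scalerAr mulr1 !scalerA; congr (_ *: _).
  by rewrite bin2_add !exprD; field; rewrite !expf_neq0.
have -> : (dft_bound n = (n * 1 + 2 * n * 1) + (mul_bound (2 * n) + n * 1))%N.
  by rewrite /dft_bound; lia.
apply: computes_trans (computes_join cost_p cost_q) _.
apply: computes_trans cost_pq _.
apply: computes_bigcup_const => j lt_j; rewrite coef_pq //.
by apply: computes_one; apply: OpScale; right; eexists.
Qed.

End PolynomialProduct.

(** * The product in a normal basis as a straight-line computation *)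

Section NormalProduct.

(** The coordinates on 1, alpha, ..., alpha^(n-1) of the element whose coordinates
on the conjugates of the sum of the tau_j alpha^j are the x_i. *)
Definition kummer_poly (B : comNzRingType) n (zeta : B) (tau x : nat -> B) :=
  \poly_(j < n) (tau j * \sum_(i < n) zeta ^+ (i * j) * x i).

(** The effect of alpha^n = a on a polynomial in alpha of degree less than 2n. *)
Definition kummer_reduce (B : comNzRingType) n (a : B) (P : {poly B}) j :=
  P`_j + a * P`_(j + n).

(** Inverts [kummer_poly], when zeta', n' and tau' j are the inverses of zeta, n
and tau j. *)
Definition kummer_interpolate (B : comNzRingType) n (zeta' n' : B) (tau' w : nat -> B) i :=
  n' * \sum_(j < n) zeta' ^+ (j * i) * (tau' j * w j).

(** The parameters live in the ring of the operands, so that the same formula makes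
sense for indeterminates and for values, and commutes with evaluation. *)
Definition normal_product (B : comNzRingType) n (zeta zeta' n' a : B)
    (tau tau' x y : nat -> B) :=
  kummer_interpolate n zeta' n' tau'
    (kummer_reduce n a (kummer_poly n zeta tau x * kummer_poly n zeta tau y)).

Lemma rmorph_normal_product (B C : comNzRingType) (phi : {rmorphism B -> C})
    n zeta zeta' n' a tau tau' x y i :
  phi (normal_product n zeta zeta' n' a tau tau' x y i) =
  normal_product n (phi zeta) (phi zeta') (phi n') (phi a)
    (phi \o tau) (phi \o tau') (phi \o x) (phi \o y) i.
Proof.
have poly_phi z : map_poly phi (kummer_poly n zeta tau z) =
    kummer_poly n (phi zeta) (phi \o tau) (phi \o z).
  apply/polyP => j; rewrite coef_map !coef_poly; case: ifP => _; last exact: rmorph0.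
  rewrite /= rmorphM rmorph_sum; congr (_ * _); apply: eq_bigr => k _.
  by rewrite rmorphM rmorphXn.
rewrite /normal_product /kummer_interpolate /kummer_reduce -!poly_phi -rmorphM.
rewrite rmorphM rmorph_sum; congr (_ * _); apply: eq_bigr => j _.
by rewrite rmorphM rmorphXn rmorphM rmorphD rmorphM !coef_map.
Qed.

Definition normal_bound n :=
  ((dft_bound n + n) + (dft_bound n + n) + (mul_bound n + 3 * n) + (dft_bound n + n))%N.

Lemma normal_bound_le n : (1 < n)%N ->
  (normal_bound n <= 60 * (1000 * (n * up_log 2 (4 * n) * up_log 2 (up_log 2 (4 * n)))))%N.
Proof.
move=> n_gt1; rewrite /normal_bound /dft_bound /mul_bound.
have -> : (2 * (2 * n) = 4 * n)%N by ring.
set l := up_log 2 (4 * n); set s := up_log 2 l.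
have mul_le : (n * up_log 2 (2 * n) * up_log 2 (up_log 2 (2 * n)) <= n * l * s)%N.
  have le_l : (up_log 2 (2 * n) <= l)%N by apply: leq_up_log; lia.
  by apply: leq_mul; [rewrite leq_mul2l le_l orbT | apply: leq_up_log].
have l_gt1 : (1 < l)%N.
  have := up_logP (4 * n) (isT : 1 < 2)%N; rewrite -/l.
  by case: (l) => [|[|]] //; rewrite ?expn0 ?expn1; lia.
have s_gt0 : (0 < s)%N by rewrite up_log_gt0.
have le_n : (n <= n * l * s)%N by rewrite -mulnA leq_pmulr // muln_gt0 s_gt0 ltnW.
have E2 : (2 * n * l * s = 2 * (n * l * s))%N by ring.
by rewrite E2; move: mul_le le_n; move: (n * l * s)%N (_ * _ * _)%N => X Y; lia.
Qed.

Variables (K : fieldType) (A : comAlgType K) (r : nat).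
Hypotheses (r_small : (r == 2) || (r == 3)) (r_neq0 : r%:R != 0 :> K).

Lemma dft_scale_cost (zeta : K) (c : nat -> K) n S (x : nat -> A) : (0 < n)%N -> zeta != 0 ->
    (forall i, (i < n)%N -> or_zero S (x i)) ->
  computes (dft_bound n + n) S
    (fun b => exists2 j, (j < n)%N & b = (c j)%:A * \sum_(i < n) zeta%:A ^+ (i * j) * x i).
Proof.
move=> n_gt0 zeta_neq0 xS.
apply: computes_trans (dft_cost r_small r_neq0 n_gt0 zeta_neq0 xS) _.
rewrite -[X in computes X]muln1; apply: computes_bigcup_const => j lt_j.
rewrite mulr_algl; apply: computes_one; apply: OpScale; right; exists j => //.
by apply: eq_bigr => i _; rewrite exprZn expr1n.
Qed.

Lemma normal_product_cost (zeta zeta' n' a : K) (tau tau' : nat -> K) n S (x y : nat -> A) :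
    (1 < n)%N -> zeta != 0 -> zeta' != 0 ->
    (forall i, (i < n)%N -> or_zero S (x i)) ->
    (forall i, (i < n)%N -> or_zero S (y i)) ->
  computes (normal_bound n) S
    (fun b => exists2 i, (i < n)%N & b = normal_product n zeta%:A zeta'%:A n'%:A a%:A
       (fun j => (tau j)%:A) (fun j => (tau' j)%:A) x y i).
Proof.
move=> n_gt1 zeta_neq0 zeta'_neq0 xS yS; have n_gt0 := ltnW n_gt1.
pose P z := kummer_poly n (zeta%:A : A) (fun j => (tau j)%:A) z.
have cost_P z : (forall i, (i < n)%N -> or_zero S (z i)) ->
    computes (dft_bound n + n) S (coefs (P z)).
  move=> zS; apply: computes_mono (dft_scale_cost tau n_gt0 zeta_neq0 zS) => //.
  move=> b [j ->]; rewrite coef_poly; case: ifP => [lt_j|_]; last by left.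
  by right; exists j.
have cost_PQ : computes (mul_bound n) (join (coefs (P x)) (coefs (P y))) (coefs (P x * P y)).
  apply: (mul_cost r_small r_neq0 n_gt1); try exact: size_poly.
    exact: covered_joinl.
  exact: covered_joinr.
pose w := kummer_reduce n (a%:A : A) (P x * P y).
have cost_w : computes (n * (1 + 1 + 1)) (coefs (P x * P y))
    (fun b => exists2 j, (j < n)%N & b = (tau' j)%:A * w j).
  apply: computes_bigcup_const => j _; rewrite /w /kummer_reduce !mulr_algl.
  apply: computes_trans (computes_seq (computes_one (OpScale a _)) (computes_one (OpAdd _ _)))
    (computes_one (OpScale _ _)).
  - by right; exists (j + n)%N.
  - by right; left; exists j.
  - by right; right.
  - by right.
have cost_z : computes (dft_bound n + n)
    (fun b => exists2 j, (j < n)%N & b = (tau' j)%:A * w j)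
    (fun b => exists2 i, (i < n)%N
       & b = kummer_interpolate n zeta'%:A n'%:A (fun j => (tau' j)%:A) w i).
  by apply: (@dft_scale_cost zeta' (fun=> n') n _ (fun j => (tau' j)%:A * w j))
    => // i lt_i; right; exists i.
have -> : normal_bound n = ((dft_bound n + n) + (dft_bound n + n) +
    (mul_bound n + (n * (1 + 1 + 1) + (dft_bound n + n))))%N by rewrite /normal_bound; lia.
apply: computes_trans (computes_join (cost_P x xS) (cost_P y yS)) _.
exact: computes_trans cost_PQ (computes_trans cost_w cost_z).
Qed.

End NormalProduct.

(** * The Kummer extension *)

Section KummerExtension.

Variables (K : fieldType) (n : nat) (a : K).
Hypotheses (n_gt0 : (0 < n)%N) (a_neq0 : a != 0).

Local Notation h := ('X^n - a%:P).

(** The companion matrix C of q is a root of q, hence of X^n - a; taking determinants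
in C^n = a gives the claim. *)
Lemma power_of_divisor (q : {poly K}) : q \is monic -> (1 < size q)%N -> q %| h ->
  nth_power_group n (a ^+ (size q).-1).
Proof.
move=> q_monic q_gt1 q_dvd.
have : exists C : 'M[K]_((size q).-1), char_poly C = q.
  by exists (companionmx q); apply: companionmxK.
case: (size q) q_gt1 => [|[|d]] //= _ [C charC].
have hC : C ^+ n = a%:M.
  have /eqP : horner_mx C h = 0.
    case/dvdpP: q_dvd => q' ->.
    by rewrite rmorphM /= -charC Cayley_Hamilton mulr0.
  by rewrite rmorphB /= rmorphXn /= horner_mx_X horner_mx_C subr_eq0 => /eqP.
have det_C : \det C ^+ n = a ^+ d.+1.
  rewrite -(@det_scalar K d.+1 a) -hC; elim: (n) => [|k IH]; first by rewrite !expr0 det1.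
  by rewrite !exprS det_mulmx IH.
exists (\det C); last by rewrite det_C.
apply/eqP => det0; move/eqP: det_C.
by rewrite det0 expr0n gtn_eqF // eq_sym expf_eq0 (negPf a_neq0) andbF.
Qed.

Hypothesis a_order : class_has_order n a n.

Lemma irreducible_kummer : irreducible_poly h.
Proof.
have h_neq0 : h != 0 by rewrite -size_poly_eq0 size_XnsubC.
split; first by rewrite size_XnsubC.
move=> q q_neq1 q_dvd; have q_neq0 : q != 0 by apply: contraTneq q_dvd => ->; rewrite dvd0p.
have q_gt1 : (1 < size q)%N by rewrite ltn_neqAle eq_sym q_neq1 size_poly_gt0.
pose q1 := (lead_coef q)^-1 *: q.
have lc_neq0 : (lead_coef q)^-1 != 0 by rewrite invr_eq0 lead_coef_eq0.
have size_q1 : size q1 = size q by rewrite size_scale.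
have q1_monic : q1 \is monic by rewrite monicE lead_coefZ mulVf ?lead_coef_eq0.
have := power_of_divisor q1_monic; rewrite size_q1 dvdpZl // => /(_ q_gt1 q_dvd).
case: a_order => _ _ min_n /min_n le_n.
rewrite -dvdp_size_eqp // size_XnsubC // eqn_leq.
rewrite -[X in (_ <= X)%N && _](size_XnsubC a n_gt0) dvdp_leq //=.
by rewrite -(prednK (ltnW q_gt1)) ltnS le_n // -ltnS prednK // ltnW.
Qed.

(** The n distinct roots zeta^i alpha of X^n - a lie in the field generated by one
of them, which is therefore the splitting field of a separable polynomial. *)
Lemma kummer_splitting (zeta : K) : n.-primitive_root zeta ->
  exists (L : splittingFieldType K) (alpha : L),
    [/\ \dim {:L} = n, alpha ^+ n = a%:A, <<1; alpha>>%VS = fullv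
      & galois 1 {:L}].
Proof.
move=> zeta_prim.
have [L dimL [alpha root_alpha alpha_gen]] := irredp_FAdjoin irreducible_kummer.
have alpha_n : alpha ^+ n = a%:A.
  move: root_alpha; rewrite rmorphB /= map_polyXn map_polyC /= rootE.
  by rewrite !hornerE subr_eq0 => /eqP.
have alpha_neq0 : alpha != 0.
  apply/eqP => alpha0; move/eqP: alpha_n.
  by rewrite alpha0 expr0n gtn_eqF // eq_sym scaler_eq0 oner_eq0 orbF (negPf a_neq0).
pose P : {poly L} := 'X^n - (a%:A)%:P.
pose rs : seq L := [seq (zeta ^+ val i)%:A * alpha | i : 'I_n].
have size_rs : size rs = n by rewrite size_map size_enum_ord.
have P_over : P \is a polyOver 1%VS.
  by rewrite rpredB ?rpredX ?polyOverX // polyOverC memvZ // mem1v.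
have uniq_rs : uniq rs.
  rewrite map_inj_uniq ?enum_uniq // => i j /(mulIf alpha_neq0).
  move/(fmorph_inj (in_alg L)) => /eqP.
  by rewrite (eq_prim_root_expr zeta_prim) !modn_small ?ltn_ord // => /eqP/val_inj.
have P_split : P = \prod_(z <- rs) ('X - z%:P).
  rewrite (@all_roots_prod_XsubC _ P rs) ?uniq_rootsE //.
  - by rewrite lead_coefXnsubC // scale1r.
  - by rewrite size_XnsubC // size_rs.
  - apply/allP => _ /mapP[i _ ->]; rewrite rootE !hornerE exprMn alpha_n exprZn expr1n.
    by rewrite exprAC (prim_expr_order zeta_prim) expr1n scale1r mul1r subrr.
have split_P : splittingFieldFor 1 P {:L}.
  exists rs; first by rewrite P_split eqpxx.
  apply/eqP; rewrite eqEsubv subvf -alpha_gen.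
  apply/FadjoinP; split; first exact: sub1_agenv.
  apply: seqv_sub_adjoin; apply/mapP; exists (Ordinal n_gt0); rewrite ?mem_enum //.
  by rewrite expr0 scale1r mul1r.
have split_L : SplittingField.axiom L by exists P.
pose L' : splittingFieldType K := HB.pack L (FieldExt_isSplittingField.Build K L split_L).
exists L', alpha; split=> //; first by rewrite dimL size_XnsubC.
apply/(splitting_galoisField (L := L')); exists P; split=> //.
by rewrite P_split separable_prod_XsubC.
Qed.

End KummerExtension.

(** * Its Galois group *)

Section KummerGalois.

Variables (K : fieldType) (L : splittingFieldType K) (n : nat) (a zeta : K) (alpha : L).
Hypotheses (n_gt0 : (0 < n)%N) (a_neq0 : a != 0) (zeta_prim : n.-primitive_root zeta).
Hypotheses (dimL : \dim {:L} = n) (alpha_n : alpha ^+ n = a%:A).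
Hypotheses (alpha_gen : <<1; alpha>>%VS = fullv) (galL : galois 1 {:L}).

Let alpha_neq0 : alpha != 0.
Proof.
apply/eqP => alpha0; move/eqP: alpha_n.
by rewrite alpha0 expr0n gtn_eqF // eq_sym scaler_eq0 oner_eq0 orbF (negPf a_neq0).
Qed.

(** The quotient of alpha and its conjugate is an n-th root of unity, hence a power
of zeta. *)
Lemma kummer_conjugate (sigma : gal_of {:L}) :
  exists c : K, c ^+ n = 1 /\ sigma alpha = c%:A * alpha.
Proof.
have zetaL_prim : n.-primitive_root (zeta%:A : L) by rewrite (fmorph_primitive_root (in_alg L)).
have quotient_n : (sigma alpha / alpha) ^+ n = 1.
  rewrite expr_div_n -rmorphXn alpha_n /= linearZ /= rmorph1 divff //.
  by rewrite scaler_eq0 oner_eq0 orbF.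
have [i Ei] := prim_rootP zetaL_prim quotient_n.
exists (zeta ^+ i); split; first by rewrite exprAC (prim_expr_order zeta_prim) expr1n.
by rewrite -[LHS](divfK alpha_neq0) Ei exprZn expr1n.
Qed.

Lemma gal_fixes_alpha (sigma : gal_of {:L}) : sigma alpha = alpha -> sigma = 1%g.
Proof.
move=> fix_alpha; apply/eqP/gal_eqP => x _; rewrite gal_id.
have : x \in <<1; alpha>>%VS by rewrite alpha_gen memvf.
case/Fadjoin1_polyP => p ->; rewrite -horner_map /= fix_alpha; congr _.[_].
rewrite -map_poly_comp; apply: eq_map_poly => k /=.
by rewrite linearZ /= rmorph1.
Qed.

(** The map sending s to s(alpha)/alpha embeds the Galois group into the
multiplicative group of L, because its values are fixed by the group. *)
Lemma cyclic_kummer : cyclic 'Gal({:L} / 1).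
Proof.
apply: (@field_mul_group_cyclic _ _ L (fun sigma => (sigma : gal_of {:L}) alpha / alpha)).
  move=> s t _ _ /=; rewrite galM ?memvf //.
  have [c [_ Es]] := kummer_conjugate s; have [d [_ Et]] := kummer_conjugate t.
  rewrite Es rmorphM /= Et linearZ /= rmorph1 !mulfK //.
  by rewrite mulrA mulfK.
move=> s _ /=; split=> [/divr1_eq /gal_fixes_alpha //|->].
by rewrite gal_id divff.
Qed.

Lemma gal_power c (sigma : gal_of {:L}) i : sigma alpha = c%:A * alpha ->
  (sigma ^+ i)%g alpha = (c ^+ i)%:A * alpha.
Proof.
move=> Es; elim: i => [|i IH]; first by rewrite expg0 gal_id expr0 scale1r mul1r.
rewrite expgSr galM ?memvf // IH rmorphM /= Es linearZ /= rmorph1.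
by rewrite !mulr_algl scalerA exprSr.
Qed.

(** An automorphism that fixes alpha is trivial, so sigma and the root of unity by
which it multiplies alpha have the same order. *)
Lemma generator_kummer (sigma : gal_of {:L}) : generator 'Gal({:L} / 1) sigma ->
  exists c : K, n.-primitive_root c /\ sigma alpha = c%:A * alpha.
Proof.
move=> gen; have [c [cn Es]] := kummer_conjugate sigma; exists c; split=> //.
have [m m_prim m_dvd] := prim_order_exists n_gt0 cn.
have order_sigma : #[sigma]%g = n.
  move: gen; rewrite /generator => /eqP gen; rewrite orderE -gen.
  by rewrite -(galois_dim galL) dimv1 divn1.
have : (sigma ^+ m)%g = 1%g.
  by apply: gal_fixes_alpha; rewrite (gal_power _ Es) (prim_expr_order m_prim) scale1r mul1r.
move/eqP; rewrite -order_dvdn order_sigma => n_dvd.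
by have -> : n = m by apply/eqP; rewrite eqn_dvd n_dvd m_dvd.
Qed.

Local Notation ev := (horner_alg alpha).

Lemma kummer_surjective x : exists p : {poly K}, x = ev p.
Proof.
have : x \in <<1; alpha>>%VS by rewrite alpha_gen memvf.
by case/Fadjoin1_polyP => p ->; exists p.
Qed.

Hypothesis irr : irreducible_poly ('X^n - a%:P).

(** Evaluation at alpha. It is injective since a nonzero polynomial of degree less
than n is prime to the irreducible X^n - a, and so cannot vanish at alpha. *)
Lemma kummer_isomorphism :
  exists iso : {lrmorphism {poly %/ ('X^n - a%:P)} -> L}, bijective iso.
Proof.
pose h : {poly K} := 'X^n - a%:P.
have ev_h : ev h = 0.
  by rewrite rmorphB /= rmorphXn /= horner_algX horner_algC alpha_n subrr.
have size_h : size h = n.+1 by rewrite size_XnsubC.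
have h_monic : h \is monic by rewrite monicXnsubC.
have mk_h : mk_monic h = h by rewrite /mk_monic size_h h_monic ltnS n_gt0.
pose f (p : {poly %/ h}) : L := ev (p : {poly K}).
have size_lt (p : {poly %/ h}) : (size (p : {poly K}) < size h)%N.
  by apply: leq_trans (size_mk_monic p) _; rewrite mk_h.
have f_mod p : f (in_qpoly h p) = ev p.
  rewrite /f /= mk_h [in RHS](Pdiv.RingMonic.rdivp_eq h_monic p).
  by rewrite rmorphD rmorphM /= ev_h mulr0 add0r.
have f_lin : linear f by move=> k p q; rewrite /f /= linearD /= linearZ /= mulr_algl.
have f_mult : monoid_morphism f.
  split=> [|p q]; first by exact: rmorph1.
  by rewrite -[LHS]/(f (in_qpoly h ((p : {poly K}) * q))) f_mod rmorphM.
pose f_lin_mixin := GRing.isLinear.Build K {poly %/ h} L _ f f_lin.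
pose f_mult_mixin := GRing.isMonoidMorphism.Build {poly %/ h} L f f_mult.
pose iso : {lrmorphism {poly %/ h} -> L} := HB.pack f f_lin_mixin f_mult_mixin.
exists iso; have f_inj : injective f.
  move=> p q Ef; apply: val_inj; apply/eqP; rewrite -subr_eq0 /=.
  set d : {poly K} := _ - _; have ev_d : ev d = 0 by rewrite rmorphB /= -!/(f _) Ef subrr.
  have size_d : (size d < size h)%N.
    apply: leq_ltn_trans (size_polyD _ _) _; rewrite gtn_max size_polyN.
    by rewrite !size_lt.
  apply: contraT => d_neq0; have : coprimep h d.
    by rewrite irreducible_poly_coprime // gtNdvdp.
  case/Bezout_eq1_coprimepP => -[u v] /= /(congr1 (fun p => ev p)).
  by rewrite rmorphD !rmorphM /= ev_h ev_d !mulr0 addr0 rmorph1 => /eqP; rewrite eq_sym oner_eq0.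
have f_surj x : exists p, f p == x.
  by have [p ->] := kummer_surjective x; exists (in_qpoly h p); rewrite f_mod.
exists (fun x => xchoose (f_surj x)) => [p|x].
  by apply: f_inj; apply/eqP; rewrite -[_ == _]/(f _ == f p) (xchooseP (f_surj (f p))).
exact: (eqP (xchooseP (f_surj x))).
Qed.

End KummerGalois.

(** * Multiplication on conjugates through powers of alpha *)

Section NormalProductCorrect.

Variables (K : fieldType) (L : comAlgType K) (n : nat) (a c : K) (alpha : L).
Variables (tau tau' : nat -> K).
Hypotheses (n_gt0 : (0 < n)%N) (c_prim : n.-primitive_root c).
Hypotheses (alpha_n : alpha ^+ n = a%:A) (tauK : forall j, tau j * tau' j = 1).

Local Notation ev := (horner_alg alpha).

(** The image of the sum of the tau_j alpha^j by the automorphism that multiplies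
alpha by c^i. *)
Definition conjugate i := \sum_(j < n) (tau j * c ^+ (i * j)) *: alpha ^+ j.

Lemma horner_kummer_poly (x : nat -> K) :
  \sum_(i < n) x i *: conjugate i = ev (kummer_poly n c tau x).
Proof.
rewrite /kummer_poly poly_def linear_sum; under eq_bigr do rewrite scaler_sumr.
rewrite exchange_big; apply: eq_bigr => j _ /=.
rewrite linearZ /= rmorphXn /= horner_algX mulr_algl mulr_sumr scaler_suml.
by apply: eq_bigr => i _; rewrite scalerA; congr (_ *: _); ring.
Qed.

Lemma horner_kummer_reduce (p : {poly K}) : (size p <= n + n)%N ->
  ev p = \sum_(j < n) kummer_reduce n a p j *: alpha ^+ j.
Proof.
move=> size_p; rewrite -[p in LHS](coefK p).
transitivity (ev (\poly_(i < n + n) p`_i)).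
  congr (ev _); apply/polyP => i; rewrite !coef_poly.
  case: ltnP => [lt_i|le_i]; first by rewrite (leq_trans lt_i).
  by rewrite nth_default ?if_same.
rewrite poly_def linear_sum big_split_ord /= -big_split /=; apply: eq_bigr => j _.
rewrite !linearZ /= !rmorphXn /= horner_algX !mulr_algl.
by rewrite exprD alpha_n mulr_algl scalerA scalerDl [(n + j)%N]addnC mulrC.
Qed.

Lemma sum_character j k : (j < n)%N -> (k < n)%N ->
  \sum_(i < n) c^-1 ^+ (k * i) * c ^+ (i * j) = if j == k then n%:R else 0.
Proof.
move=> lt_j lt_k; have c_neq0 : c != 0.
  apply/eqP => c0; have := prim_expr_order c_prim.
  by rewrite c0 expr0n gtn_eqF // => /eqP; rewrite eq_sym oner_eq0.
have term i : c^-1 ^+ (k * i) * c ^+ (i * j) = (c ^+ j / c ^+ k) ^+ i.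
  by rewrite expr_div_n -!exprM exprVn mulrC (mulnC i).
under eq_bigr do rewrite term.
have [->|neq_jk] := eqVneq j k.
  rewrite divff ?expf_neq0 //; under eq_bigr do rewrite expr1n.
  by rewrite sumr_const card_ord.
apply/eqP; have := subrX1 (c ^+ j / c ^+ k) n.
rewrite expr_div_n -!exprM !(mulnC _ n) !exprM (prim_expr_order c_prim) !expr1n divr1 subrr.
move/eqP; rewrite eq_sym mulf_eq0 subr_eq0 => /orP[|//].
rewrite (can2_eq (divfK _) (mulfK _)) ?expf_neq0 // mul1r.
by rewrite (eq_prim_root_expr c_prim) !modn_small // (negPf neq_jk).
Qed.

(** Orthogonality of the characters of the cyclic group of order n. *)
Lemma interpolate_conjugates (w : nat -> K) :
  \sum_(i < n) kummer_interpolate n c^-1 n%:R^-1 tau' w i *: conjugate i =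
  \sum_(j < n) w j *: alpha ^+ j.
Proof.
under eq_bigr do rewrite scaler_sumr.
rewrite exchange_big; apply: eq_bigr => j _ /=.
under eq_bigr do rewrite scalerA.
rewrite -scaler_suml; congr (_ *: _).
transitivity (\sum_(k < n) n%:R^-1 * tau' k * w k * tau j *
    \sum_(i < n) c^-1 ^+ (k * i) * c ^+ (i * j)).
  under [RHS]eq_bigr do rewrite mulr_sumr.
  rewrite exchange_big; apply: eq_bigr => i _ /=.
  rewrite /kummer_interpolate mulr_sumr mulr_suml; apply: eq_bigr => k _; ring.
rewrite (bigD1 j) //= sum_character // eqxx big1 ?addr0 => [|k neq_kj].
  transitivity (n%:R^-1 * n%:R * (tau j * tau' j) * w j); first by ring.
  by rewrite tauK mulVf ?mul1r // (prim_root_natf_neq0 c_prim).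
by move: neq_kj; rewrite -val_eqE eq_sym sum_character // => /negPf /= ->; rewrite mulr0.
Qed.

Lemma normal_product_correct (x y : nat -> K) :
  (\sum_(i < n) x i *: conjugate i) * (\sum_(i < n) y i *: conjugate i) =
  \sum_(i < n) normal_product n c c^-1 n%:R^-1 a tau tau' x y i *: conjugate i.
Proof.
rewrite /normal_product interpolate_conjugates !horner_kummer_poly -rmorphM /=.
rewrite horner_kummer_reduce //.
apply: leq_trans (size_polyMleq _ _) _; apply: leq_trans (leq_pred _) _.
by apply: leq_add; apply: size_poly.
Qed.

End NormalProductCorrect.

(** * The normal basis generated by 1/(alpha - 1) *)

Section KummerNormalBasis.

Variables (K : fieldType) (L : splittingFieldType K) (n : nat) (a c : K) (alpha : L).
Variable (sigma : gal_of {:L}).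
Hypotheses (n_gt1 : (1 < n)%N) (a_neq1 : a != 1) (c_prim : n.-primitive_root c).
Hypotheses (dimL : \dim {:L} = n) (alpha_n : alpha ^+ n = a%:A).
Hypotheses (alpha_gen : <<1; alpha>>%VS = fullv) (sigma_alpha : sigma alpha = c%:A * alpha).

Let n_gt0 : (0 < n)%N := ltnW n_gt1.

Definition kummer_generator : L := (alpha - 1)^-1.

Local Notation theta := kummer_generator.
Local Notation Theta := (galois_conjugates n sigma theta).
Local Notation conj := (conjugate n c alpha (fun=> (a - 1)^-1)).

Let pole i : L := (c ^+ i)%:A * alpha.

Let pole_n i : pole i ^+ n = a%:A.
Proof.
rewrite exprMn alpha_n exprZn expr1n exprAC (prim_expr_order c_prim).
by rewrite expr1n scale1r mul1r.
Qed.

Let pole_neq1 i : pole i - 1 != 0.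
Proof.
rewrite subr_eq0; apply/eqP => pole1; have := pole_n i; rewrite pole1 expr1n.
move/eqP; rewrite -[X in X == _]scale1r -subr_eq0 -scalerBl scaler_eq0 oner_eq0 orbF.
by rewrite subr_eq0 eq_sym (negPf a_neq1).
Qed.

Lemma gal_kummer_generator i : (sigma ^+ i)%g theta = (pole i - 1)^-1.
Proof. by rewrite fmorphV rmorphB /= rmorph1 (gal_power _ sigma_alpha). Qed.

(** For b = c^i alpha, the geometric series 1 + b + ... + b^(n-1) is
(b^n - 1) / (b - 1), and b^n = a whatever i is. *)
Lemma kummer_generator_expansion i : (pole i - 1)^-1 = conj i.
Proof.
have a1_neq0 : a - 1 != 0 by rewrite subr_eq0.
apply: (mulfI (pole_neq1 i)); rewrite divff //.
transitivity ((a - 1)^-1 *: ((pole i - 1) * \sum_(j < n) pole i ^+ j)).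
  have a1E : a%:A - 1 = (a - 1)%:A :> L by rewrite scalerBl scale1r.
  by rewrite -subrX1 pole_n a1E scalerA mulVf // scale1r.
rewrite scalerAr; congr (_ * _); rewrite scaler_sumr; apply: eq_bigr => j _.
by rewrite exprMn exprZn expr1n -exprM mulr_algl scalerA.
Qed.

Lemma nth_conjugates i : (i < n)%N -> Theta`_i = conj i.
Proof.
move=> lt_i; rewrite -kummer_generator_expansion -gal_kummer_generator.
rewrite (nth_map (Ordinal lt_i)) ?size_enum_ord //.
by rewrite nth_enum_ord.
Qed.

(** The powers of alpha are recovered from the conjugates of theta by interpolation,
because no coefficient of the expansion of theta vanishes. *)
Lemma kummer_normal_basis : normal_basis n sigma theta.
Proof.
have a1 (j : nat) : (fun=> (a - 1)^-1) j * (fun=> a - 1) j = 1 :> K.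
  by rewrite mulVf // subr_eq0.
split; first by have := pole_neq1 0; rewrite /pole expr0 scale1r mul1r invr_eq0.
rewrite basisEdim size_tuple dimL leqnn andbT; apply/subvP => x _.
have power_span j : alpha ^+ j \in <<Theta>>%VS.
  rewrite (divn_eq j n) exprD mulnC exprM alpha_n exprZn expr1n mulr_algl memvZ //.
  have lt_j : (j %% n < n)%N by rewrite ltn_mod.
  have <- : \sum_(k < n) (k == Ordinal lt_j)%:R *: alpha ^+ k = alpha ^+ (j %% n).
    rewrite (bigD1 (Ordinal lt_j)) //= eqxx scale1r big1 ?addr0 // => k /negPf->.
    exact: scale0r.
  rewrite -(interpolate_conjugates alpha n_gt0 c_prim a1 (fun k => (k == Ordinal lt_j :> nat)%:R)).
  apply: memv_suml => i _; apply: memvZ; rewrite -nth_conjugates //.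
  by apply: memv_span; rewrite mem_nth // size_tuple.
have [p ->] := kummer_surjective alpha_gen x.
rewrite -[p]coefK poly_def linear_sum; apply: memv_suml => j _.
by rewrite linearZ /= rmorphXn /= horner_algX mulr_algl memvZ.
Qed.

Let free_Theta : free Theta.
Proof. by case: kummer_normal_basis => _ /basis_free. Qed.

(** With A = c^i and B = c^j, this is the decomposition
(B - A) / ((A alpha - 1) (B alpha - 1)) = A / (A alpha - 1) - B / (B alpha - 1). *)
Lemma kummer_partial_fractions i j : (i < n)%N -> (j < n)%N -> i != j ->
  exists u v : K, Theta`_i * Theta`_j = u *: Theta`_i + v *: Theta`_j.
Proof.
move=> lt_i lt_j neq_ij.
rewrite !nth_conjugates // -!kummer_generator_expansion.
have d_neq0 : c ^+ j - c ^+ i != 0.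
  rewrite subr_eq0 (eq_prim_root_expr c_prim) !modn_small // eq_sym //.
exists (c ^+ i / (c ^+ j - c ^+ i)), (- (c ^+ j / (c ^+ j - c ^+ i))).
set d := c ^+ j - c ^+ i in d_neq0 *.
have dA : d%:A * (pole i - 1)^-1 * (pole j - 1)^-1 =
   (c ^+ i)%:A * (pole i - 1)^-1 - (c ^+ j)%:A * (pole j - 1)^-1.
  have -> : d%:A = (c ^+ j)%:A - (c ^+ i)%:A :> L by rewrite scalerBl.
  have := pole_neq1 i; have := pole_neq1 j; rewrite /pole.
  move: (c ^+ i)%:A (c ^+ j)%:A => A B B_neq0 A_neq0; field; by rewrite A_neq0 B_neq0.
have -> : (pole i - 1)^-1 * (pole j - 1)^-1 =
    d^-1 *: (d%:A * (pole i - 1)^-1 * (pole j - 1)^-1).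
  by rewrite -mulrA mulr_algl scalerA mulVf // scale1r.
rewrite dA scalerBr !mulr_algl !scalerA scaleNr; congr (_ *: _ - _ *: _); exact: mulrC.
Qed.

(** A pair of distinct nonzero indices contributes nothing to the coordinate of
index 0 by [kummer_partial_fractions]. *)
Lemma weight_kummer : (weight n_gt0 Theta <= 3 * n - 2)%N.
Proof.
pose o := Ordinal n_gt0.
have coord_Theta i j : coord Theta i Theta`_(val j) = (i == j)%:R.
  by rewrite coord_free // eq_sym.
pose rows := [set (o, j) | j : 'I_n].
pose cols := [set (i, o) | i in [set~ o]].
pose diag := [set (i, i) | i in [set~ o]].
apply: (@leq_trans #|rows :|: cols :|: diag|).
  apply: subset_leq_card; apply/subsetP => -[i j]; rewrite inE /struct_const /=.
  apply: contraR; rewrite !inE !negb_or => /andP[/andP[not_row not_col] not_diag].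
  have i_neq0 : i != o.
    by apply: contraNneq not_row => ->; apply/imsetP; exists j.
  have j_neq0 : j != o.
    by apply: contraNneq not_col => ->; apply/imsetP; exists i; rewrite ?inE.
  have ij_neq : i != j.
    by apply: contraNneq not_diag => <-; apply/imsetP; exists i; rewrite ?inE.
  rewrite !(tnth_nth 0).
  have [u [v ->]] := kummer_partial_fractions (ltn_ord i) (ltn_ord j) ij_neq.
  rewrite linearD !linearZ /= !coord_Theta.
  by rewrite ![o == _]eq_sym (negPf i_neq0) (negPf j_neq0) !mulr0 addr0.
have card_C1 : #|[set~ o]| = n.-1 by rewrite cardsC1 card_ord.
have card_rows : (#|rows| <= n)%N by rewrite -[X in (_ <= X)%N]card_ord leq_imset_card.
have card_cols : (#|cols| <= n.-1)%N by rewrite -card_C1 leq_imset_card.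
have card_diag : (#|diag| <= n.-1)%N by rewrite -card_C1 leq_imset_card.
rewrite (leq_trans (leq_card_setU _ _)) //.
apply: (@leq_trans (n + n.-1 + n.-1)%N); last by lia.
rewrite leq_add // (leq_trans (leq_card_setU _ _)) // leq_add //.
Qed.

End KummerNormalBasis.

(** * Complexity of the normal basis *)

Section KummerComplexity.

Lemma has_complexity_of_program (K : fieldType) (L : splittingFieldType K) n
    (Theta : n.-tuple L) prog b :
  computes_product Theta prog -> (size prog <= b)%N ->
  exists2 c, has_complexity Theta c & (c <= b)%N.
Proof.
move=> prog_ok size_prog.
pose P c := boolp.asbool (exists2 q, computes_product Theta q & size q = c).
have exP : exists c, P c by exists (size prog); apply/boolp.asboolP; exists prog.
case: (ex_minnP exP) => c /boolp.asboolP c_ok c_min; exists c.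
  by split=> // q q_ok; apply: c_min; apply/boolp.asboolP; exists q.
by apply: leq_trans size_prog; apply: c_min; apply/boolp.asboolP; exists prog.
Qed.

Lemma eq_normal_product (B : comNzRingType) n (zeta zeta' n' a : B)
    (tau1 tau2 tau1' tau2' x1 x2 y1 y2 : nat -> B) i :
    (forall j, (j < n)%N -> tau1 j = tau2 j) -> (forall j, (j < n)%N -> tau1' j = tau2' j) ->
    (forall j, (j < n)%N -> x1 j = x2 j) -> (forall j, (j < n)%N -> y1 j = y2 j) ->
  normal_product n zeta zeta' n' a tau1 tau1' x1 y1 i =
  normal_product n zeta zeta' n' a tau2 tau2' x2 y2 i.
Proof.
move=> Etau Etau' Ex Ey.
have E z1 z2 : (forall j, (j < n)%N -> z1 j = z2 j) ->
    kummer_poly n zeta tau1 z1 = kummer_poly n zeta tau2 z2.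
  move=> Ez; apply/polyP => j; rewrite !coef_poly; case: ifP => // lt_j.
  by rewrite Etau //; congr (_ * _); apply: eq_bigr => k _; rewrite Ez.
rewrite /normal_product (E x1 x2) // (E y1 y2) //; congr (_ * _).
by apply: eq_bigr => j _; rewrite Etau'.
Qed.

Variables (K : fieldType) (L : splittingFieldType K) (n : nat) (a c : K) (alpha : L).
Variables (tau tau' : nat -> K) (Theta : n.-tuple L) (r : nat).
Hypotheses (n_gt1 : (1 < n)%N) (c_prim : n.-primitive_root c).
Hypotheses (alpha_n : alpha ^+ n = a%:A) (tauK : forall j, tau j * tau' j = 1).
Hypotheses (Theta_basis : basis_of {:L} Theta).
Hypotheses (nth_Theta : forall i, (i < n)%N -> Theta`_i = conjugate n c alpha tau i).
Hypotheses (r_small : (r == 2) || (r == 3)) (r_neq0 : r%:R != 0 :> K).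

Let n_gt0 : (0 < n)%N := ltnW n_gt1.

Lemma coord_product (x y : L) (k : 'I_n) :
  coord Theta k (x * y) =
  normal_product n c c^-1 n%:R^-1 a tau tau'
    (nth 0 (coords Theta x)) (nth 0 (coords Theta y)) k.
Proof.
have expand z : z = \sum_(i < n) (coords Theta z)`_i *: conjugate n c alpha tau i.
  rewrite [LHS](coord_basis Theta_basis) ?memvf //; apply: eq_bigr => i _.
  rewrite nth_Theta //; congr (_ *: _).
  by rewrite (nth_map i) ?size_enum_ord // nth_ord_enum.
rewrite [x in LHS]expand [y in LHS]expand (normal_product_correct n_gt0 c_prim alpha_n tauK).
under eq_bigr => i _ do rewrite -nth_Theta //.
by rewrite coord_sum_free // (basis_free Theta_basis).
Qed.

(** The costs are applied to the indeterminates of a polynomial ring, and evaluation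
at the coordinates of x and y specializes the outcome. The first instruction
provides a register holding 0. *)
Lemma kummer_program : exists2 prog, computes_product Theta prog &
  (size prog <= (normal_bound n).+1)%N.
Proof.
pose A : comAlgType K := {mpoly K[n + n]}.
pose vars : seq A := [seq 'X_u | u : 'I_(n + n)].
pose input (xy : L * L) := coords Theta xy.1 ++ coords Theta xy.2.
pose phi xy : {lrmorphism A -> K | *%R} := meval (fun u : 'I_(n + n) => (input xy)`_u).
have size_coords x : size (coords Theta x) = n by rewrite size_map size_enum_ord.
have size_input xy : size (input xy) = (n + n)%N by rewrite size_cat !size_coords.
have phi_vars xy i : (i < n + n)%N -> phi xy vars`_i = (input xy)`_i.
  move=> lt_i; rewrite (nth_map (Ordinal lt_i)) ?size_enum_ord //= mevalXU.
  by rewrite nth_enum_ord.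
pose S (b : A) := exists2 i, (i < n + n)%N & b = vars`_i.
have c_neq0 : c != 0.
  apply/eqP => c0; have := prim_expr_order c_prim.
  by rewrite c0 expr0n gtn_eqF // => /eqP; rewrite eq_sym oner_eq0.
have cost : computes (normal_bound n) S (fun b => exists2 i, (i < n)%N &
   b = normal_product n c%:A (c^-1)%:A (n%:R^-1)%:A a%:A (fun j => (tau j)%:A)
     (fun j => (tau' j)%:A) (nth 0 vars) (fun i => vars`_(n + i)) i).
  apply: (normal_product_cost r_small r_neq0) => //; rewrite ?invr_eq0 //.
    by move=> i lt_i; right; exists i => //; rewrite (leq_trans lt_i) ?leq_addr.
  by move=> i lt_i; right; exists (n + i)%N => //; rewrite ltn_add2l.
have [||prog [wf_prog size_prog prog_ok]] :=
    program_of_computes (phi := phi) (regs := fun xy => rcons (input xy) 0)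
      (nreg := (n + n).+1) _ _ cost.
- by move=> xy; rewrite size_rcons size_input.
- move=> b [->|[i lt_i ->]].
    exists (n + n)%N => // xy.
    by rewrite nth_rcons size_input ltnn eqxx rmorph0.
  exists i; first exact: ltnW.
  by move=> xy; rewrite nth_rcons size_input lt_i phi_vars.
exists (SubReg K 0 0 :: prog); last by rewrite /= ltnS.
pose np i := normal_product n c%:A (c^-1)%:A (n%:R^-1)%:A a%:A (fun j => (tau j)%:A)
     (fun j => (tau' j)%:A) (nth 0 vars) (fun i => vars`_(n + i)) i.
have outs (k : 'I_n) : exists o, (o < (n + n).+1 + size prog)%N /\
    forall xy, (run prog (rcons (input xy) 0))`_o = phi xy (np k).
  by have [|o lt_o Eo] := prog_ok (np k); [exists k | exists o].
have [out out_ok] := fin_all_exists outs.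
exists out; split.
- by rewrite /= addn_gt0 n_gt0.
- by move=> k; rewrite /= addnS -addSn; case: (out_ok k).
- move=> x y k; rewrite /= subrr; have [_ /(_ (x, y)) /= ->] := out_ok k.
  rewrite coord_product /np rmorph_normal_product /=.
  have phi_scalar (k' : K) : phi (x, y) k'%:A = k' by rewrite linearZ /= rmorph1 mulr1.
  rewrite !phi_scalar; apply: eq_normal_product => i lt_i /=.
  - exact: phi_scalar.
  - exact: phi_scalar.
  - by rewrite [LHS](phi_vars (x, y)) ?nth_cat ?size_coords ?lt_i // (leq_trans lt_i) ?leq_addr.
  - by rewrite [LHS](phi_vars (x, y)) ?ltn_add2l // nth_cat size_coords ltnNge leq_addr addKn.
Qed.

End KummerComplexity.

(** * The logarithmic estimate *)

Section Asymptotics.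

Local Notation expR := sequences.expR.

Variable R : realType.
Implicit Types (x : R) (n : nat).

(** Both inequalities come from 1 + x <= exp x, at x = 1/2 with (3/2)^2 > 2, and at
x = -1/6 with (6/5)^6 < 3. *)
Lemma expR1_bounds : 2 < expR (1 : R) < 3.
Proof.
apply/andP; split.
  have -> : expR 1 = expR (2^-1) ^+ 2 :> R by rewrite -expRM_natl; congr expR; field.
  by have := expR_ge1Dx (2^-1 : R); nra.
have -> : expR 1 = (expR (- 6^-1) ^+ 6)^-1 :> R.
  by rewrite -expRM_natl -expRN; congr expR; field.
have e6 : 5 / 6 <= expR (- 6^-1) :> R by apply: le_trans (expR_ge1Dx _); lra.
rewrite -[3]invrK ltf_pV2 ?posrE ?invr_gt0 ?exprn_gt0 ?expR_gt0 //.
apply: (@lt_le_trans _ _ ((5 / 6) ^+ 6)); last by rewrite lerXn2r ?nnegrE ?expR_ge0 //; lra.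
lra.
Qed.

Lemma ln_nat_gt0 n : (1 < n)%N -> 0 < ln n%:R :> R.
Proof. by move=> n_gt1; rewrite ln_gt0 // ltr1n. Qed.

Lemma ln2_lt1 : ln 2 < 1 :> R.
Proof.
have /andP[e2 _] := expR1_bounds.
by rewrite -[X in _ < X]expRK ltr_ln ?posrE ?expR_gt0.
Qed.

Lemma ln3_gt1 : 1 < ln 3 :> R.
Proof.
have /andP[_ e3] := expR1_bounds.
by rewrite -[X in X < _]expRK ltr_ln ?posrE ?expR_gt0.
Qed.

Lemma up_log2_le k : (0 < k)%N -> (up_log 2 k)%:R <= 1 + ln k%:R / ln 2 :> R.
Proof.
move=> k_gt0; have L2 : 0 < ln 2 :> R by apply: ln_nat_gt0.
have [k_le1|k_gt1] := leqP k 1.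
  have -> : k = 1%N by lia.
  by rewrite up_log1 ln1 mul0r addr0 ler01.
rewrite -lerBlDl ler_pdivlMr //.
have := up_log_gtn (isT : 1 < 2)%N k_gt1; have : (0 < up_log 2 k)%N by rewrite up_log_gt0.
case: (up_log 2 k) => // l _ /ltnW /=.
rewrite -natr1 addrK -(ler_nat R) natrX => le_k.
by rewrite mulr_natl -lnXn // ler_ln ?posrE ?exprn_gt0 ?ltr0n.
Qed.

(** The value n = 2 is treated apart because ln (ln 2) is negative; from n = 3 on,
ln (ln n) is bounded below by ln (ln 3) > 0, and the additive constants are
absorbed in the multiplicative one. *)
Lemma logarithmic_bound : exists2 C : R, 0 <= C & forall n, (1 < n)%N ->
  (n * up_log 2 (4 * n) * up_log 2 (up_log 2 (4 * n)))%:R <=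
  C * (n%:R * ln n%:R * `|ln `|ln (n%:R : R)| |).
Proof.
have L2 : 0 < ln 2 :> R by apply: ln_nat_gt0.
have L2_1 := ln2_lt1; have L3 := ln3_gt1.
pose kappa := ln (ln 3) : R; have kappa_gt0 : 0 < kappa by rewrite ln_gt0.
pose M : R := 4 / ln 2; have M_gt0 : 0 < M by rewrite divr_gt0.
have lnM_ge0 : 0 <= ln M by rewrite ln_ge0 // /M ler_pdivlMr //; lra.
pose D := (1 + ln M / ln 2) / kappa + 1 / ln 2.
have D_ge0 : 0 <= D by rewrite addr_ge0 // divr_ge0 // ?addr_ge0 // ?divr_ge0 // ltW.
pose lnln2 := - ln (ln 2) : R; have lnln2_gt0 : 0 < lnln2 by rewrite oppr_gt0 ln_lt0 // L2.
pose C2 := 6 / (ln 2 * lnln2); have C2_ge0 : 0 <= C2 by rewrite divr_ge0 // mulr_ge0 // ltW.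
have MD_ge0 : 0 <= M * D by rewrite mulr_ge0 // ltW.
exists (M * D + C2); first by rewrite addr_ge0.
move=> n n_gt1; have Ln := ln_nat_gt0 n_gt1; rewrite (gtr0_norm Ln).
have [n_le2|n_gt2] := leqP n 2.
  have -> : n = 2%N by apply/eqP; rewrite eqn_leq n_le2.
  rewrite -[(2 * _ * _)%N]/12%N ltr0_norm ?ln_lt0 ?L2 // -/lnln2.
  have E12 : C2 * (2 * ln 2 * lnln2) = 12.
    by rewrite /C2; field; rewrite !gt_eqF.
  by rewrite mulrDl E12 lerDr mulr_ge0 // mulr_ge0 ?mulr_ge0 // ltW.
have n_gt0 := ltnW n_gt1.
have le_3n : ln 3 <= ln n%:R :> R by rewrite ler_ln ?posrE ?ltr0n // ler_nat.
have lnln_ge : kappa <= ln (ln n%:R) by rewrite ler_ln ?posrE // (lt_trans ltr01).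
rewrite (ger0_norm (le_trans (ltW kappa_gt0) lnln_ge)).
set l := up_log 2 (4 * n); set s := up_log 2 l.
have l_gt0 : (0 < l)%N by rewrite up_log_gt0 /=; apply: leq_trans n_gt1 (leq_pmull _ _).
have le_l : l%:R <= M * ln n%:R :> R.
  apply: le_trans (up_log2_le _) _; first by rewrite muln_gt0.
  rewrite natrM lnM ?posrE ?ltr0n // /M.
  have -> : ln 4 = 2 * ln 2 :> R.
    by rewrite [4](_ : _ = 2 ^+ 2) ?lnXn ?mulr_natl // -natrX.
  rewrite mulrDl mulfK ?gt_eqF //.
  have -> : 4 / ln 2 * ln n%:R = 4 * (ln n%:R / ln 2) :> R by rewrite mulrAC mulrA.
  have : 1 <= ln n%:R / ln 2 :> R.
    by rewrite ler_pdivlMr // mul1r ler_ln ?posrE ?ltr0n // ler_nat.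
  lra.
have le_s : s%:R <= D * ln (ln n%:R) :> R.
  apply: le_trans (up_log2_le l_gt0) _.
  have le_lnl : ln l%:R <= ln M + ln (ln n%:R) :> R.
    by rewrite -lnM ?posrE // ler_ln ?posrE ?ltr0n // mulr_gt0.
  apply: (@le_trans _ _ (1 + (ln M + ln (ln n%:R)) / ln 2)).
    by rewrite lerD2l ler_pM2r // invr_gt0.
  rewrite [(_ + _) / ln 2]mulrDl addrA /D mulrDl lerD //; last by rewrite mul1r mulrC.
  rewrite mulrAC -mulrA ler_peMr //; first by rewrite addr_ge0 // divr_ge0 // ltW.
  by rewrite ler_pdivlMr // mul1r.
rewrite !natrM -mulrA; set y := ln (ln n%:R) in lnln_ge le_s *.
have y_gt0 : 0 < y by apply: lt_le_trans lnln_ge.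
have le_ls : l%:R * s%:R <= (M * ln n%:R) * (D * y) by rewrite ler_pM.
apply: (@le_trans _ _ (n%:R * ((M * ln n%:R) * (D * y)))); first by rewrite ler_wpM2l.
rewrite [(M * D + C2) * _]mulrDl.
have -> : n%:R * (M * ln n%:R * (D * y)) = M * D * (n%:R * ln n%:R * y) by ring.
by rewrite lerDl mulr_ge0 // mulr_ge0 ?mulr_ge0 // ltW.
Qed.

End Asymptotics.

(** * Kummer extensions in characteristic p *)

(** The radix has to be inverted after the inverse Fourier transforms. *)
Lemma invertible_radix (K : fieldType) p : p \in [pchar K] ->
  exists r : nat, ((r == 2) || (r == 3)) /\ r%:R != 0 :> K.
Proof.
move=> charK; have [p2|p_neq2] := eqVneq p 2%N.
  by exists 3; rewrite -(dvdn_pcharf charK) p2.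
exists 2; rewrite -(dvdn_pcharf charK) dvdn_prime2 ?(pcharf_prime charK) //.
Qed.

Theorem theorem1p2 (R : realType) :
  exists C : R,
  forall (K : fieldType) (p : nat) (charK : p \in [pchar K])
    (m n : nat) (m_gt1 : (1 < m)%N) (n_gt1 : (1 < n)%N)
    (mn_p : coprime (m * n) p)
    (zeta_mn : exists zeta : K, (m * n).-primitive_root zeta)
    (a : K) (a_neq0 : a != 0) (a_order : class_has_order n a n),
  exists (L : splittingFieldType K)
    (iso : {lrmorphism {poly %/ ('X^n - a%:P)} -> L}),
  [/\ bijective iso,
      cyclic_extension L n
    & forall sigma : gal_of {:L}, generator 'Gal({:L} / 1) sigma ->
      exists theta : L,
      [/\ normal_basis n sigma theta,
          (weight (ltnW n_gt1) (galois_conjugates n sigma theta) <= 3 * n - 2)%N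
        & exists2 c : nat, has_complexity (galois_conjugates n sigma theta) c &
          c%:R <= C * (n%:R * ln n%:R * `|ln `|ln (n%:R : R)| |)]].
Proof.
have [C C_ge0 bound] := logarithmic_bound R.
exists (61 * 1000 * C) => K p charK m n m_gt1 n_gt1 mn_p [zeta zeta_mn] a a_neq0 a_order.
have n_gt0 := ltnW n_gt1.
have zeta_prim := dvdn_prim_root zeta_mn (dvdn_mull m (dvdnn n)).
have a_neq1 : a != 1.
  apply/eqP => a1; suff: (n <= 1)%N by rewrite leqNgt n_gt1.
  case: a_order => _ _ min_n; apply: min_n => //.
  by exists 1; rewrite ?oner_neq0 // a1 !expr1n.
have [L [alpha [dimL alpha_n alpha_gen galL]]] :=
  kummer_splitting n_gt0 a_neq0 a_order zeta_prim.
have [iso iso_bij] := kummer_isomorphism n_gt0 alpha_n alpha_gen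
  (irreducible_kummer n_gt0 a_neq0 a_order).
exists L, iso; split=> //.
  split=> //.
  exact: (cyclic_kummer n_gt0 a_neq0 zeta_prim alpha_n alpha_gen).
move=> sigma sigma_gen.
have [c [c_prim sigma_alpha]] :=
  generator_kummer n_gt0 a_neq0 zeta_prim dimL alpha_n alpha_gen galL sigma_gen.
exists (kummer_generator alpha).
have normal := kummer_normal_basis n_gt1 a_neq1 c_prim dimL alpha_n alpha_gen sigma_alpha.
split=> //.
  exact: (weight_kummer n_gt1 a_neq1 c_prim dimL alpha_n alpha_gen sigma_alpha).
have [r [r_small r_neq0]] := invertible_radix charK.
have tauK (j : nat) : (fun=> (a - 1)^-1) j * (fun=> a - 1) j = 1 :> K.
  by rewrite mulVf // subr_eq0.
have [prog prog_ok size_prog] := kummer_program n_gt1 c_prim alpha_n tauK (proj2 normal)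
  (nth_conjugates a_neq1 c_prim alpha_n sigma_alpha) r_small r_neq0.
have [b b_ok le_b] := has_complexity_of_program prog_ok size_prog.
exists b => //; set X := (n * up_log 2 (4 * n) * up_log 2 (up_log 2 (4 * n)))%N.
have le_bX : (b <= 61 * (1000 * X))%N.
  have := normal_bound_le n_gt1; rewrite -/X; have : (n <= normal_bound n)%N.
    by rewrite /normal_bound; lia.
  by move: le_b; clearbody X; move: (normal_bound n) => N; clear -n_gt0; lia.
apply: (@le_trans _ _ (61 * (1000 * X))%:R); first by rewrite ler_nat.
rewrite natrM natrM -/X; set Y := _ * `|_|.
have -> : 61 * 1000 * C * Y = 61 * (1000 * (C * Y)) by rewrite !mulrA.
by rewrite !ler_pM2l ?ltr0n //; apply: bound.
Qed.
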